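(* Let $p_d$ denote the number of isomorphism classes of perfect $d$-dimensional primitive integral lattices (equivalently, the number of similarity classes of perfect $d$-dimensional Euclidean lattices). For every $\epsilon>0$ there exists $N(\epsilon)$ such that for all $d\ge N(\epsilon)$, $$e^{d^{1-\epsilon}}<p_d<e^{d^{3+\epsilon}}.$$
   Context: A lattice is a discrete subgroup $\Lambda$ of a Euclidean vector space; its dimension (rank) is $d=\dim(\Lambda\otimes_{\mathbb Z}\mathbb R)$. $\Lambda_{\min}$ denotes the set of nonzero vectors of $\Lambda$ of minimal length. $\Lambda$ is perfect if the tensors $\{v\otimes v\}_{v\in\Lambda_{\min}}$ span the full $\binom{d+1}{2}$-dimensional space of symmetric tensors in $(\Lambda\otimes\mathbb R)\otimes_{\mathbb R}(\Lambda\otimes\mathbb R)$. A lattice is primitive integral if all scalar products of its elements are integers and the set of all these scalar products has greatest common divisor $1$. *)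

(* Defs.v *)
From Stdlib Require Import Reals ZArith List.
Import ListNotations.

(* A rank-d lattice with a chosen basis b_0..b_{d-1} is encoded by its Gram
   matrix A i j = <b_i, b_j>; lattice vectors are coordinate vectors
   x : nat -> Z (only indices < d matter).  For an integral lattice A has
   integer entries. *)
Definition zmat := nat -> nat -> Z.
Definition zvec := nat -> Z.

Definition sumZ (d : nat) (f : nat -> Z) : Z :=
  fold_right (fun i acc => (f i + acc)%Z) 0%Z (seq 0 d).
Definition sumR (d : nat) (f : nat -> R) : R :=
  fold_right (fun i acc => (f i + acc)%R) 0%R (seq 0 d).

Definition bil (d : nat) (A : zmat) (x y : zvec) : Z :=
  sumZ d (fun i => sumZ d (fun j => (x i * A i j * y j)%Z)).

Definition nonzero_vec (d : nat) (x : zvec) : Prop :=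
  exists i, (i < d)%nat /\ x i <> 0%Z.

Definition is_gram (d : nat) (A : zmat) : Prop :=
  (forall i j, (i < d)%nat -> (j < d)%nat -> A i j = A j i) /\
  (forall x, nonzero_vec d x -> (0 < bil d A x x)%Z).

Definition primitive (d : nat) (A : zmat) : Prop :=
  forall g : Z, (forall x y, (g | bil d A x y)%Z) -> (g | 1)%Z.

Definition min_vec (d : nat) (A : zmat) (v : zvec) : Prop :=
  nonzero_vec d v /\ forall x, nonzero_vec d x -> (bil d A v v <= bil d A x x)%Z.

(* perfect: the tensors v (x) v, v in Lambda_min, span all symmetric tensors
   of (Lambda (x) R)^{(x) 2}, i.e. every real symmetric d x d matrix is a
   finite real linear combination of the matrices v v^T. *)
Definition perfect (d : nat) (A : zmat) : Prop :=
  forall S : nat -> nat -> R,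
    (forall i j, (i < d)%nat -> (j < d)%nat -> S i j = S j i) ->
    exists l : list (R * zvec),
      (forall c v, In (c, v) l -> min_vec d A v) /\
      forall i j, (i < d)%nat -> (j < d)%nat ->
        S i j = fold_right (fun cv acc => (fst cv * IZR (snd cv i) * IZR (snd cv j) + acc)%R)
                  0%R l.

Definition perfect_prim_integral (d : nat) (A : zmat) : Prop :=
  is_gram d A /\ primitive d A /\ perfect d A.

Definition zmul (d : nat) (P Q : zmat) : zmat :=
  fun i j => sumZ d (fun k => (P i k * Q k j)%Z).
Definition is_id (d : nat) (M : zmat) : Prop :=
  forall i j, (i < d)%nat -> (j < d)%nat -> M i j = (if Nat.eqb i j then 1 else 0)%Z.
Definition lat_iso (d : nat) (A B : zmat) : Prop :=
  exists P Q : zmat, is_id d (zmul d P Q) /\ is_id d (zmul d Q P) /\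
    forall i j, (i < d)%nat -> (j < d)%nat ->
      B i j = sumZ d (fun k => sumZ d (fun l => (P k i * A k l * P l j)%Z)).

Definition perfect_class_count (d n : nat) : Prop :=
  exists l : list zmat,
    length l = n /\
    (forall A, In A l -> perfect_prim_integral d A) /\
    (forall i j, (i < j)%nat -> (j < n)%nat ->
        ~ lat_iso d (nth i l (fun _ _ => 0%Z)) (nth j l (fun _ _ => 0%Z))) /\
    (forall A, perfect_prim_integral d A -> exists B, In B l /\ lat_iso d A B).

(* Main.v *)
Require Import Defs.
From Stdlib Require Import Reals ZArith List ClassicalEpsilon Lra Lia.

(** Upper bound.  Choose [d] minimal vectors [v_1, ..., v_d] of a perfect lattice
    with maximal determinant.  Two lattice points in the same box of side [1/d]
    of the parallelotope of the [v_i] would differ by a vector shorter than the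
    minimum, so the index [I] of the span of the [v_i] is at most [d ^ d].  By
    Cramer's rule all minimal vectors have coordinates in [[-1, 1]] with respect
    to the [v_i], which leaves at most [I * 3 ^ d] candidates.  The class of the
    lattice is determined by [I], by the adjugate of the [v_i] modulo [I] and by
    at most [d ^ 2] minimal vectors among these candidates, hence there are
    [exp (O (d ^ 3 ln d))] classes.

    Lower bound.  For a binary code of length [d] with only even words, of
    minimal distance 4, the integer vectors reducing modulo 2 to a codeword form
    a lattice of minimum 4 which is perfect as soon as any two positions lie in
    a word of weight 4.  Parity checks with columns [(1, s)], for [s] in a subset
    [S] of [F_2 ^ (m + 2)], yield such codes when [S] contains a subspace of
    codimension 2 and at least five points of each of its cosets.  The vectors
    [2 e_i] are then the only minimal vectors with even scalar products with the
    whole lattice, so that an isometry permutes the positions and transforms [S]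
    by a linear map.  There are [exp (c d)] subsets [S] but only
    [exp (O ((ln d) ^ 2))] linear maps. *)

(** * Comparison of logarithms with powers *)

Section Asymptotics.
Open Scope R_scope.

(** With [y = ln d], [exp (eps y)] is the square of [exp (eps y / 2)], hence exceeds
    [(eps y / 2) ^ 2], and this is at least [C y] once [y >= 4 C / eps ^ 2]. *)
Lemma ln_lt_Rpower (eps C : R) : 0 < eps -> 0 < C ->
  exists N : nat, (1 <= N)%nat /\
    forall d : nat, (N <= d)%nat -> 1 <= ln (INR d) /\ C * ln (INR d) < Rpower (INR d) eps.
Proof.
intros he hC.
set (Y := Rmax 1 (4 * C / (eps * eps))).
destruct (INR_unbounded (exp Y)) as [N hN].
assert (hN1 : (1 <= N)%nat).
{ apply INR_le; simpl; pose proof (exp_ineq1_le Y); pose proof (Rmax_l 1 (4 * C / (eps * eps))).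
  fold Y in H0; lra. }
exists N; split; [exact hN1|]; intros d hd.
assert (hNd : INR N <= INR d) by (apply le_INR; exact hd).
assert (hd0 : 0 < INR d) by (pose proof (exp_pos Y); lra).
assert (hy : Y <= ln (INR d)).
{ rewrite <- (ln_exp Y); apply Rlt_le, ln_increasing; [apply exp_pos | lra]. }
set (y := ln (INR d)) in *.
assert (h1 : 1 <= Y) by apply Rmax_l.
assert (h2 : 4 * C / (eps * eps) <= Y) by apply Rmax_r.
split; [lra|].
unfold Rpower; fold y.
replace (eps * y) with (eps * y / 2 + eps * y / 2) by field; rewrite exp_plus.
pose proof (exp_ineq1_le (eps * y / 2)) as he1.
assert (hey : 0 < eps * y) by (apply Rmult_lt_0_compat; lra).
assert (hC' : 4 * C <= eps * eps * y).
{ apply Rmult_le_reg_l with (/ (eps * eps)); [apply Rinv_0_lt_compat; nra|].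
  replace (/ (eps * eps) * (eps * eps * y)) with y by (field; lra).
  replace (/ (eps * eps) * (4 * C)) with (4 * C / (eps * eps)) by (field; lra); lra. }
assert (hsq : (eps * y / 2) * (eps * y / 2) < exp (eps * y / 2) * exp (eps * y / 2)).
{ apply Rmult_le_0_lt_compat; lra. }
nra.
Qed.

Lemma INR_pow_exp (a k : nat) : (1 <= a)%nat -> INR (a ^ k) = exp (INR k * ln (INR a)).
Proof.
intros ha; assert (0 < INR a) by (apply lt_0_INR; lia).
rewrite pow_INR, <- Rpower_pow by assumption; reflexivity.
Qed.

Lemma upper_asymptotics (eps : R) : 0 < eps ->
  exists N : nat, forall d p : nat, (N <= d)%nat -> (p <= d ^ (6 * d ^ 3))%nat ->
    INR p < exp (Rpower (INR d) (3 + eps)).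
Proof.
intros he; destruct (ln_lt_Rpower eps 6 he ltac:(lra)) as [N [hN1 hN]].
exists N; intros d p hd hp; destruct (hN d hd) as [_ hln].
assert (hd0 : 0 < INR d) by (apply lt_0_INR; lia).
apply Rle_lt_trans with (INR (d ^ (6 * d ^ 3))); [apply le_INR; exact hp|].
rewrite INR_pow_exp by lia; apply exp_increasing.
rewrite Rpower_plus, mult_INR, pow_INR.
replace 3 with (INR 3) at 1 by (simpl; lra); rewrite Rpower_pow by assumption.
replace (INR 6) with 6 by (simpl; lra).
assert (0 < INR d ^ 3) by (apply pow_lt; assumption).
nra.
Qed.

(** Since [ln 2 > 1/2], the exponent [k ln 2] of [2 ^ k] exceeds [d / 48], while
    [48 <= 48 ln d < d ^ eps]. *)
Lemma lower_asymptotics (eps : R) : 0 < eps ->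
  exists N : nat, forall d p k : nat, (N <= d)%nat -> (d <= 24 * k)%nat -> (2 ^ k <= p)%nat ->
    exp (Rpower (INR d) (1 - eps)) < INR p.
Proof.
intros he; destruct (ln_lt_Rpower eps 48 he ltac:(lra)) as [N [hN1 hN]].
exists N; intros d p k hd hk hp; destruct (hN d hd) as [hl hln].
assert (hd0 : 0 < INR d) by (apply lt_0_INR; lia).
apply Rlt_le_trans with (INR (2 ^ k)); [|apply le_INR; exact hp].
rewrite INR_pow_exp by lia; apply exp_increasing.
assert (hk' : INR d <= 24 * INR k).
{ replace 24 with (INR 24) by (simpl; lra); rewrite <- mult_INR; apply le_INR; exact hk. }
pose proof ln_lt_2 as h2; replace (INR 2) with 2 by (simpl; lra).
assert (h48 : Rpower (INR d) (1 - eps) * Rpower (INR d) eps = INR d).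
{ rewrite <- Rpower_plus; replace (1 - eps + eps) with 1 by ring; apply Rpower_1; assumption. }
assert (hpos : 0 < Rpower (INR d) (1 - eps)) by (unfold Rpower; apply exp_pos).
assert (hlt : Rpower (INR d) (1 - eps) * 48 < INR d).
{ rewrite <- h48 at 2; apply Rmult_lt_compat_l; lra. }
nra.
Qed.
End Asymptotics.

Module PerfectLattices.
From HB Require Import structures.
From mathcomp Require Import all_boot all_order all_algebra fingroup perm.
From mathcomp Require Import ssrZ Rstruct zify.
From mathcomp.algebra_tactics Require Import ring.

Set Implicit Arguments.
Unset Strict Implicit.
Unset Printing Implicit Defensive.
Import Order.TTheory GRing.Theory Num.Theory.
Local Open Scope ring_scope.

(** * Gram matrices over [int] *)
Definition row_of_zvec d (x : zvec) : 'rV[int]_d := \row_i int_of_Z (x i).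
Definition mx_of_zmat d (A : zmat) : 'M[int]_d := \matrix_(i, j) int_of_Z (A i j).
Definition zvec_of_row d (x : 'rV[int]_d) : zvec :=
  fun i => if insub i is Some i' then Z_of_int (x 0 i') else Z0.
Definition zmat_of_mx d (A : 'M[int]_d) : zmat :=
  fun i j => match insub i, insub j with
             | Some i', Some j' => Z_of_int (A i' j')
             | _, _ => Z0
             end.

Definition qf d (A : 'M[int]_d) (x : 'rV[int]_d) : int := (x *m A *m x^T) 0 0.
Definition posdef d (A : 'M[int]_d) : Prop :=
  A^T = A /\ forall x, x != 0 -> 0 < qf A x.
Definition minrow d (A : 'M[int]_d) (v : 'rV[int]_d) : Prop :=
  v != 0 /\ forall x, x != 0 -> qf A v <= qf A x.
Definition primmx d (A : 'M[int]_d) : Prop :=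
  forall g : int, (forall i j, (g %| A i j)%Z) -> (g %| 1)%Z.
Definition tensor d (v : 'rV[int]_d) : 'M[R]_d := map_mx intr (v^T *m v).
Definition perfmx d (A : 'M[int]_d) : Prop :=
  forall S : 'M[R]_d, S^T = S ->
  exists l : seq (R * 'rV[int]_d),
    (forall p, p \in l -> minrow A p.2) /\
    S = \sum_(p <- l) p.1 *: tensor p.2.
Definition ppimx d (A : 'M[int]_d) : Prop := [/\ posdef A, primmx A & perfmx A].
Definition isomx d (A B : 'M[int]_d) : Prop :=
  exists2 P, P \in unitmx & B = P^T *m A *m P.

(** * Translation of Gram matrices on [nat] and [Z] into matrices over [int] *)

Section Bridge.
Variable d : nat.
Implicit Types (A B : zmat) (M : 'M[int]_d) (x y : zvec).

Lemma row_of_zvecK : cancel (@zvec_of_row d) (@row_of_zvec d).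
Proof. by move=> x; apply/rowP=> i; rewrite mxE /zvec_of_row valK Z_of_intK. Qed.

Lemma mx_of_zmatK : cancel (@zmat_of_mx d) (@mx_of_zmat d).
Proof. by move=> x; apply/matrixP=> i j; rewrite mxE /zmat_of_mx !valK Z_of_intK. Qed.

Lemma int_of_ZM (a b : Z) : int_of_Z (Z.mul a b) = int_of_Z a * int_of_Z b.
Proof. exact: (rmorphM int_of_Z a b). Qed.

Lemma IZR_int z : IZR z = (int_of_Z z)%:~R :> R.
Proof.
case: z => [|p|p] //=.
- by rewrite -[LHS]/(IPR p) -INR_IPR INRE.
- rewrite -[LHS]/(Ropp (IPR p)) -INR_IPR INRE NegzE mulrNz; congr (- _).
  by rewrite -pmulrn prednK //; case: (Pos2Nat.is_succ p) => n ->.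
Qed.

Lemma foldr_seqE (V : nmodType) (g : nat -> V -> V) (f : nat -> V) a n :
  (forall i u, g i u = f i + u) ->
  fold_right g 0 (List.seq a n) = \sum_(i < n) f (a + i)%N.
Proof.
move=> gE; elim: n a => [|n IH] a /=; first by rewrite big_ord0.
rewrite gE IH big_ord_recl /= addn0; congr (_ + _).
by apply: eq_bigr => i _; rewrite addSnnS.
Qed.

Lemma sumZE (f : nat -> Z) : int_of_Z (sumZ d f) = \sum_(i < d) int_of_Z (f i).
Proof. by rewrite /sumZ (foldr_seqE (f := f)) // raddf_sum. Qed.

Lemma bilE A x y :
  int_of_Z (bil d A x y)
  = (row_of_zvec d x *m mx_of_zmat d A *m (row_of_zvec d y)^T) 0 0.
Proof.
rewrite /bil sumZE mxE.
under [RHS]eq_bigr => j _ do rewrite !mxE mulr_suml.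
rewrite [RHS]exchange_big; apply: eq_bigr => i _; rewrite sumZE.
by apply: eq_bigr => j _; rewrite !mxE !int_of_ZM.
Qed.

Lemma nonzero_vecE x : nonzero_vec d x <-> row_of_zvec d x != 0.
Proof.
split=> [[i [/ssrnat.ltP ltid xi]]|].
  apply/eqP=> /rowP/(_ (Ordinal ltid)); rewrite !mxE /= => xi0.
  by apply: xi; rewrite -[x i]int_of_ZK xi0.
case/rV0Pn=> i; rewrite mxE => xi; exists i; split; first exact/ssrnat.ltP.
by move=> xi0; rewrite xi0 in xi.
Qed.

Lemma ltZE (a b : Z) : Z.lt a b <-> (int_of_Z a < int_of_Z b).
Proof. lia. Qed.
Lemma leZE (a b : Z) : Z.le a b <-> (int_of_Z a <= int_of_Z b).
Proof. lia. Qed.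

Lemma divZE (a b : Z) : Z.divide a b <-> (int_of_Z a %| int_of_Z b)%Z.
Proof.
split=> [[c ->]|/dvdzP[c cE]]; first by rewrite int_of_ZM dvdz_mull.
by exists (Z_of_int c); apply: (can_inj int_of_ZK); rewrite int_of_ZM Z_of_intK.
Qed.

Lemma is_gramE A : is_gram d A <-> posdef (mx_of_zmat d A).
Proof.
split=> -[sA pA]; split.
- apply/matrixP=> i j; rewrite !mxE sA //; exact/ssrnat.ltP.
- move=> x x0; rewrite -[x]row_of_zvecK /qf -bilE -[0]/(int_of_Z Z0).
  by apply/ltZE/pA/nonzero_vecE; rewrite row_of_zvecK.
- move=> i j /ssrnat.ltP lti /ssrnat.ltP ltj; move/matrixP/(_ (Ordinal ltj) (Ordinal lti)): sA.
  by rewrite !mxE /=; apply: (can_inj int_of_ZK).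
- by move=> x /nonzero_vecE/pA; rewrite /qf -bilE -[0]/(int_of_Z Z0) => /ltZE.
Qed.

Lemma min_vecE A v : Defs.min_vec d A v <-> minrow (mx_of_zmat d A) (row_of_zvec d v).
Proof.
split=> -[/nonzero_vecE v0 vm]; split=> //.
- move=> x x0; rewrite -[x]row_of_zvecK /qf -!bilE.
  by apply/leZE/vm/nonzero_vecE; rewrite row_of_zvecK.
- by move=> x /nonzero_vecE/vm; rewrite /qf -!bilE => /leZE.
Qed.

Lemma primitiveE A : Defs.primitive d A <-> primmx (mx_of_zmat d A).
Proof.
split=> pA g gA.
  have: Z.divide (Z_of_int g) (Zpos xH); last by move/divZE; rewrite Z_of_intK.
  apply: pA => x y; apply/divZE.
  rewrite bilE Z_of_intK mxE rpred_sum // => i _; rewrite dvdz_mulr // mxE.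
  by rewrite rpred_sum // => j _; rewrite dvdz_mull.
apply/divZE/pA => i j.
have := gA (zvec_of_row (delta_mx 0 i)) (zvec_of_row (delta_mx 0 j)).
move/divZE; rewrite bilE !row_of_zvecK trmx_delta -rowE -colE !mxE; apply.
Qed.

Lemma perfectE A : Defs.perfect d A <-> perfmx (mx_of_zmat d A).
Proof.
split=> pA S sS.
  pose S' i j := if insub i is Some i' then if insub j is Some j' then S i' j' else 0 else 0 : R.
  have [|l [lm lS]] := pA S'.
    move=> i j /ssrnat.ltP lti /ssrnat.ltP ltj; rewrite /S' !insubT -[in LHS]sS mxE //.
  exists [seq (p.1, row_of_zvec d p.2) | p <- l]; split.
    elim: l lm {lS} => // -[c v] l IH lm p; rewrite inE => /predU1P[->|pl] /=.
      by apply/min_vecE/(lm c); left.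
    by apply: IH pl => c' v' cv'; apply: (lm c'); right.
  apply/matrixP=> i j; have := lS i j; rewrite /S' !valK => ->; try exact/ssrnat.ltP.
  rewrite summxE big_map; elim: l {lm lS} => [|[c v] l IH] /=; first by rewrite big_nil.
  by rewrite big_cons IH !mxE big_ord1 !mxE !IZR_int rmorphM mulrA.
have [|l [lm lS]] := pA (\matrix_(i, j) S i j).
  by apply/matrixP=> i j; rewrite !mxE sS //; exact/ssrnat.ltP.
exists [seq (p.1, zvec_of_row p.2) | p <- l]; split.
  elim: l lm {lS} => // -[c v] l IH lm c' v' [[_ <-]|pl].
    by apply/min_vecE; rewrite row_of_zvecK; apply: (lm (c, v)); rewrite mem_head.
  by apply: (IH _ _ _ pl) => p pl'; apply: lm; rewrite inE pl' orbT.
move=> i j /ssrnat.ltP lti /ssrnat.ltP ltj.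
move/matrixP/(_ (Ordinal lti) (Ordinal ltj)): lS; rewrite mxE /= => ->.
rewrite summxE; elim: l {lm} => [|[c v] l IH] /=; first by rewrite big_nil.
rewrite big_cons IH !mxE big_ord1 !mxE !IZR_int /= rmorphM mulrA /zvec_of_row.
by rewrite !insubT !Z_of_intK.
Qed.

Lemma perfect_prim_integralE A : perfect_prim_integral d A <-> ppimx (mx_of_zmat d A).
Proof.
split=> [[/is_gramE ? [/primitiveE ? /perfectE ?]]|[/is_gramE ? /primitiveE ? /perfectE ?]] //.
Qed.

Lemma zmulE A B : mx_of_zmat d (zmul d A B) = mx_of_zmat d A *m mx_of_zmat d B.
Proof.
apply/matrixP=> i j; rewrite !mxE sumZE.
by apply: eq_bigr => k _; rewrite !mxE !int_of_ZM.
Qed.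

Lemma is_idE A : is_id d A <-> mx_of_zmat d A = 1%:M.
Proof.
split=> [idA|/matrixP idA i j /ssrnat.ltP lti /ssrnat.ltP ltj].
  apply/matrixP=> i j; rewrite !mxE idA; try exact/ssrnat.ltP.
  by rewrite -val_eqE /=; case: Nat.eqb_spec => [->|/eqP/negPf->]; rewrite ?eqxx.
have := idA (Ordinal lti) (Ordinal ltj); rewrite !mxE -val_eqE /= => Aij.
apply: (can_inj int_of_ZK); rewrite Aij.
by case: Nat.eqb_spec => [->|/eqP/negPf->]; rewrite ?eqxx.
Qed.

Lemma lat_isoE A B : lat_iso d A B <-> isomx (mx_of_zmat d A) (mx_of_zmat d B).
Proof.
have key P i j : int_of_Z (sumZ d (fun k => sumZ d (fun l => Z.mul (Z.mul (P k i) (A k l)) (P l j))))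
  = \sum_(k < d) \sum_(l < d) int_of_Z (P k i) * int_of_Z (A k l) * int_of_Z (P l j).
  rewrite sumZE; apply: eq_bigr => k _; rewrite sumZE; apply: eq_bigr => l _.
  by rewrite !int_of_ZM.
have key2 P (i j : 'I_d) : ((mx_of_zmat d P)^T *m mx_of_zmat d A *m mx_of_zmat d P) i j
  = \sum_(k < d) \sum_(l < d) int_of_Z (P k i) * int_of_Z (A k l) * int_of_Z (P l j).
  rewrite mxE exchange_big /=; apply: eq_bigr => k _; rewrite !mxE mulr_suml.
  by apply: eq_bigr => l _; rewrite !mxE.
split=> [[P [Q [/is_idE PQ [_ BE]]]]|[P uP BE]].
  rewrite zmulE in PQ; exists (mx_of_zmat d P); first by case/mulmx1_unit: PQ.
  by apply/matrixP=> i j; rewrite key2 -key mxE BE //; exact/ssrnat.ltP.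
exists (zmat_of_mx P), (zmat_of_mx (invmx P)); split.
  by apply/is_idE; rewrite zmulE !mx_of_zmatK mulmxV.
split; first by apply/is_idE; rewrite zmulE !mx_of_zmatK mulVmx.
move=> i j /ssrnat.ltP lti /ssrnat.ltP ltj; apply: (can_inj int_of_ZK).
rewrite key -[P]mx_of_zmatK in BE *.
by move/matrixP/(_ (Ordinal lti) (Ordinal ltj)): BE; rewrite key2 !mxE mx_of_zmatK.
Qed.
End Bridge.

Lemma isomx_sym d (A B : 'M[int]_d) : isomx A B -> isomx B A.
Proof.
case=> P uP ->; exists (invmx P); first by rewrite unitmx_inv.
by rewrite !mulmxA -trmx_mul mulmxV // trmx1 mul1mx mulmxK.
Qed.

Lemma isomx_trans d (A B C : 'M[int]_d) : isomx A B -> isomx B C -> isomx A C.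
Proof.
move=> [P uP ->] [Q uQ ->]; exists (P *m Q); first by rewrite unitmx_mul uP.
by rewrite trmx_mul !mulmxA.
Qed.

Lemma scale_cancel (n p : nat) (c : int) (M N : 'M[int]_(n, p)) :
  c != 0 -> c *: M = c *: N -> M = N.
Proof.
move=> c0 /matrixP E; apply/matrixP=> i j; have := E i j; rewrite !mxE; exact: mulfI.
Qed.

(** * Counting isomorphism classes *)

Lemma nth_mapE (T U : Type) (f : T -> U) (l : seq T) i a b :
  (i < size l)%N -> List.nth i (List.map f l) a = f (nth b l i).
Proof. by elim: l i => [|c l IH] [|i] //= /IH. Qed.

Section ClassCount.
Variable d : nat.

(** Greedy selection: for each code in turn, keep a lattice carrying it that is isomorphic to none
    kept so far, if there is one. A code is a relation because it will depend on choices, so that a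
    lattice may carry several codes. *)
Lemma representatives (K : finType) (code : 'M[int]_d -> K -> Prop) (ks : seq K) :
  (forall A A' c, ppimx A -> ppimx A' -> code A c -> code A' c -> isomx A A') ->
  exists l : seq 'M[int]_d,
    [/\ (size l <= size ks)%N, (forall A, A \in l -> ppimx A),
        (forall i j, (i < j < size l)%N -> ~ isomx (nth 0 l i) (nth 0 l j))
      & forall A c, c \in ks -> code A c -> ppimx A -> exists2 B, B \in l & isomx A B].
Proof.
move=> codeP; elim: ks => [|c ks [l [szl lp lni lall]]].
  by exists [::]; split=> [|A|i j|A c] //; rewrite ltn0 andbF.
case: (classic (exists A, [/\ ppimx A, code A c & forall B, B \in l -> ~ isomx A B])).
  move=> [A [pA cA Anew]]; exists (A :: l); split=> //.
  - by move=> B; rewrite inE => /predU1P[->|/lp].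
  - move=> [|i] [|j] //=; last exact: lni.
    by move=> jl; apply: Anew; rewrite mem_nth.
  - move=> B c'; rewrite inE => /predU1P[->|ck] cB pB.
      by exists A; [rewrite mem_head | apply: codeP cB cA].
    by have [C Cl BC] := lall B c' ck cB pB; exists C; rewrite // inE Cl orbT.
move=> nA; exists l; split=> //; first exact: leqW.
move=> B c'; rewrite inE => /predU1P[->|ck] cB pB; last exact: lall ck cB pB.
apply: NNPP => nB; apply: nA; exists B; split=> // C Cl BC.
by apply: nB; exists C.
Qed.

Lemma class_count_le (K : finType) (code : 'M[int]_d -> K -> Prop) :
  (forall A, ppimx A -> exists c, code A c) ->
  (forall A A' c, ppimx A -> ppimx A' -> code A c -> code A' c -> isomx A A') ->
  exists2 p, (p <= #|K|)%N & perfect_class_count d p.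
Proof.
move=> hascode codeP.
have [l [szl lp lni lall]] := representatives (enum K) codeP.
exists (size l); first by rewrite cardE.
exists (map (@zmat_of_mx d) l); split; first exact: (size_map (@zmat_of_mx d) l).
split.
  move=> A Al; apply/perfect_prim_integralE.
  have [B [<- Bl]] := proj1 (List.in_map_iff _ _ _) Al; rewrite mx_of_zmatK; apply: lp.
  by elim: l Bl {szl lni lall Al} => //= C l IH [->|/IH]; rewrite inE ?eqxx // => ->; rewrite orbT.
split.
  move=> i j /ssrnat.ltP ij /ssrnat.ltP jl /lat_isoE.
  rewrite !(nth_mapE _ _ 0) ?(ltn_trans ij) // !mx_of_zmatK.
  by apply: lni; rewrite ij.
move=> A /perfect_prim_integralE pA; have [c cA] := hascode _ pA.
have [|B Bl AB] := lall _ c _ cA pA; first by rewrite mem_enum.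
exists (zmat_of_mx B); split; last by apply/lat_isoE; rewrite mx_of_zmatK.
apply/in_map_iff; exists B; split=> //.
by elim: l Bl {szl lp lni lall} => //= C l IH; rewrite inE => /predU1P[->|/IH]; [left|right].
Qed.

(** Here [N] bounds the fibres of the map sending [u] to the place of its class in the list of [p]
    representatives. *)
Lemma class_count_ge (U : finType) (f : U -> 'M[int]_d) (N p : nat) :
  perfect_class_count d p -> (forall u, ppimx (f u)) ->
  (forall D : {set U}, {in D &, forall u v, isomx (f u) (f v)} -> (#|D| <= N)%N) ->
  (#|U| <= p * N)%N.
Proof.
move=> [l [lp [_ [_ lall]]]] fp fib.
have /fin_all_exists[g gP] : forall u, exists i : 'I_p,
    isomx (f u) (mx_of_zmat d (List.nth i l (fun _ _ => Z0))).
  move=> u; have [|B [Bl /lat_isoE]] := lall (zmat_of_mx (f u)).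
    by apply/perfect_prim_integralE; rewrite mx_of_zmatK.
  rewrite mx_of_zmatK => uB; have [i [il Bi]] := In_nth _ _ (fun _ _ => Z0) Bl.
  rewrite lp in il; have ip : (i < p)%N by apply/ssrnat.ltP.
  by exists (Ordinal ip); rewrite /= Bi.
rewrite -sum1_card (partition_big g xpredT) //= -[p in (p * N)%N]card_ord -sum_nat_const.
apply: leq_sum => i _; rewrite sum1dep_card; apply: fib => u v.
rewrite !inE => /eqP ui /eqP vi; apply: isomx_trans (gP u) _.
by rewrite ui -vi; apply: isomx_sym.
Qed.
End ClassCount.

(** * The upper bound *)
Section QuadraticForm.
Variables (d : nat) (A : 'M[int]_d).

Lemma qf_mul (V : 'M[int]_d) y : qf A (y *m V) = qf (V *m A *m V^T) y.
Proof. by rewrite /qf trmx_mul !mulmxA. Qed.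

Lemma qf_sum y : qf A y = \sum_i \sum_j y 0 i * A i j * y 0 j.
Proof.
rewrite /qf mxE exchange_big /=; apply: eq_bigr => j _.
by rewrite !mxE mulr_suml; apply: eq_bigr => i _.
Qed.

Lemma qfZ (c : int) y : qf A (c *: y) = c ^+ 2 * qf A y.
Proof. by rewrite /qf linearZ /= -!scalemxAl -scalemxAr !mxE mulrA. Qed.

Hypothesis pA : posdef A.

Lemma qf_ge0 x : 0 <= qf A x.
Proof.
have [->|/(proj2 pA)/ltW //] := eqVneq x 0.
by rewrite /qf !mul0mx mxE.
Qed.

(** Expand the nonnegative norms of [v + w] and [v - w]; both vectors have the same norm. *)
Lemma minrow_form_le v w : minrow A v -> minrow A w ->
  `|(v *m A *m w^T) 0 0| <= qf A v.
Proof.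
move=> [v0 vm] [w0 wm].
have qvw : qf A w = qf A v by apply/eqP; rewrite eq_le vm // wm.
have sym : (w *m A *m v^T) 0 0 = (v *m A *m w^T) 0 0.
  have <- : (w *m A *m v^T)^T = v *m A *m w^T.
    by rewrite !trmx_mul trmxK (proj1 pA) mulmxA.
  by rewrite [RHS]mxE.
have := qf_ge0 (v + w); have := qf_ge0 (v - w).
rewrite /qf in qvw *; rewrite [(v + w)^T]linearD [(v - w)^T]linearB /=.
rewrite !mulmxDl !mulmxDr !mulNmx !mulmxN.
have addE (M N : 'M[int]_1) : (M + N) 0 0 = M 0 0 + N 0 0 by rewrite mxE.
have oppE (M : 'M[int]_1) : (- M) 0 0 = - M 0 0 by rewrite mxE.
rewrite !(addE, oppE) sym qvw ler_norml.
move: ((v *m A *m v^T) 0 0) ((v *m A *m w^T) 0 0) => a b.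
by move=> h1 h2; apply/andP; split; lia.
Qed.
End QuadraticForm.

Lemma absz_unit (x : int) : x \is a GRing.unit -> `|x|%N = 1%N.
Proof. by move=> /orP[]/eqP->. Qed.

(** * Integer vectors modulo a full sublattice *)

Section Residues.
Variables (d : nat) (V : 'M[int]_d).
Hypothesis V0 : \det V != 0.

(* [T] is the finite group [Z^d / Z^d V]; the Smith form makes it a product of
   cyclic groups, hence of order [|det V|]. *)
Lemma residue_classes : exists (T : finType) (r : 'rV[int]_d -> T) (s : T -> 'rV[int]_d),
  [/\ #|T| = `|\det V|%N, (forall x x', r x = r x' -> exists z, x - x' = z *m V)
    & forall t t' z, s t - s t' = z *m V -> t = t'].
Proof.
have [L uL [Q uQ [ds _ VE]]] := int_Smith_normal_form V.
pose a (i : 'I_d) : int := ds`_i.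
pose D := diag_mx (\row_i a i : 'rV[int]_d).
have {}VE : V = L *m D *m Q.
  rewrite VE; congr (_ *m _ *m _); apply/matrixP=> i j; by rewrite !mxE.
have dets : `|\det V|%N = (\prod_(i < d) `|a i|)%N.
  rewrite VE !det_mulmx det_diag !abszM.
  rewrite (absz_unit uL) (absz_unit uQ) muln1.
  rewrite mul1n ?muln1 (big_morph absz abszM (erefl _)).
  by apply: eq_bigr => i _; rewrite mxE.
have ds0 (i : 'I_d) : a i != 0.
  have : `|\det V|%N != 0%N by rewrite absz_eq0.
  by apply: contraNneq => ai0; rewrite dets (bigD1 i) //= ai0.
pose T := {dffun forall i : 'I_d, 'I_(`|a i|)}.
pose c (x : 'rV[int]_d) (i : 'I_d) : int := (x *m invmx Q) 0 i.
have resP (x : 'rV[int]_d) (i : 'I_d) : (`|(c x i %% a i)%Z| < `|a i|)%N.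
  by have := ltz_mod (c x i) (ds0 i); have := modz_ge0 (c x i) (ds0 i); lia.
exists T, (fun x => [ffun i => Ordinal (resP x i)] : T),
  (fun t : T => (\row_i (t i : nat)%:Z) *m Q); split.
- rewrite card_dep_ffun dets foldrE big_map big_enum /=.
  by apply: eq_bigr => i _; rewrite card_ord.
- move=> x x' /ffunP rx.
  have /fin_all_exists[u uP] (i : 'I_d) : exists u, ((x - x') *m invmx Q) 0 i = u * a i.
    apply/dvdzP; have := rx i; rewrite !ffunE => /(congr1 val) /=.
    have := modz_ge0 (c x i) (ds0 i).
    have := modz_ge0 (c x' i) (ds0 i) => h1 h2 h3.
    have -> : ((x - x') *m invmx Q) 0 i = c x i - c x' i by rewrite mulmxBl /c !mxE.
    rewrite -eqz_mod_dvd; apply/eqP; lia.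
  exists (\row_i u i *m invmx L); rewrite VE !mulmxA mulmxKV //.
  rewrite -[LHS](mulmxKV uQ); congr (_ *m _); apply/rowP=> i.
  by rewrite mul_mx_diag uP !mxE.
- move=> t t' z; rewrite -mulmxBl VE !mulmxA => /(can_inj (mulmxK uQ)) E.
  apply/ffunP=> i; apply: val_inj; move/rowP/(_ i): E; rewrite mul_mx_diag !mxE => E.
  have := ltn_ord (t i); have := ltn_ord (t' i) => h1 h2.
  rewrite /=; move: (t i : nat) (t' i : nat) h1 h2 E (ds0 i) => n n' h1 h2 E a0.
  have : (a i %| n%:Z - n'%:Z)%Z by rewrite E dvdz_mull.
  rewrite -eqz_mod_dvd -(modz_abs n) -(modz_abs n') !modz_small; lia.
Qed.
End Residues.

(** * Minimal vectors of maximal determinant *)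

Section MaximalMinors.
Variables (d : nat) (A : 'M[int]_d).
Hypotheses (d_gt0 : (0 < d)%N) (pA : posdef A).

(* If the index exceeded [d ^ d], two cosets would fall into the same box of
   side [1/d] of the fundamental parallelotope of [V]; their difference would
   be shorter than the minimum. *)
Lemma index_minrows_le (V : 'M[int]_d) :
  (forall i, minrow A (row i V)) -> \det V != 0 -> (`|\det V| <= d ^ d)%N.
Proof.
move=> Vm V0; rewrite leqNgt; apply/negP=> dV.
have [T [_ [s [cardT _ sI]]]] := residue_classes V0.
pose I := `|\det V|%N; have I0 : (0 < I)%N by rewrite absz_gt0.
(* [y t] is [det V] times the coordinate row of [s t] with respect to the rows of [V]. Reduction
   modulo [det V] translates the point by the span of [V] until its scaled coordinates lie in
   [[0, I)], and [box] cuts this interval into [d] slices. *)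
have [y yE] : exists y : T -> 'rV[int]_d, forall t, y t = s t *m \adj V by eexists.
pose rho t (i : 'I_d) : int := modz (y t 0 i) (\det V).
have rho_ge0 t i : 0 <= rho t i by apply: modz_ge0.
have rho_lt t i : rho t i < I by apply: ltz_mod.
have boxP t i : (`|rho t i| * d %/ I < d)%N.
  rewrite ltn_divLR // mulnC ltn_pmul2l //; have := rho_lt t i; have := rho_ge0 t i; lia.
pose box t := [ffun i => Ordinal (boxP t i)] : {ffun 'I_d -> 'I_d}.
have [t [t' [tt' bt]]] : exists t t', t <> t' /\ box t = box t'.
  apply: NNPP => nE; have /leq_card : injective box.
    by move=> t t' bt; apply: NNPP => tt'; apply: nE; exists t, t'.
  by rewrite card_ffun !card_ord cardT leqNgt dV.
pose e := \row_i (rho t i - rho t' i).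
pose q := \row_i (divz (y t 0 i) (\det V) - divz (y t' 0 i) (\det V)).
pose w := s t - s t' - q *m V.
have we : w *m \adj V = e.
  rewrite /w !mulmxBl -mulmxA mul_mx_adj mul_mx_scalar.
  rewrite -!yE; apply/rowP=> i; rewrite !mxE /rho.
  by rewrite {1}(divz_eq (y t 0 i) (\det V)) {1}(divz_eq (y t' 0 i) (\det V)); ring.
have w0 : w != 0.
  apply/eqP=> /eqP; rewrite subr_eq0 => /eqP ww; exact: tt' (sI _ _ _ ww).
have e_lt i : (`|e 0%R i| * d < I)%N.
  move/ffunP/(_ i): bt; rewrite !ffunE => /(congr1 val) /= bt; rewrite mxE.
  have := rho_ge0 t i; have := rho_ge0 t' i; move: bt.
  case: (rho t i) (rho t' i) => // a [] // b /= bt _ _.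
  have := divn_eq (a * d) I; have := divn_eq (b * d) I; rewrite -bt.
  by have := ltn_pmod (a * d) I0; have := ltn_pmod (b * d) I0; nia.
pose i0 := Ordinal d_gt0.
have sum_lt : (\sum_i `|e 0%R i| < I)%N.
  rewrite -(ltn_pmul2r d_gt0) big_distrl /=.
  have -> : (I * d = \sum_(i < d) I)%N by rewrite sum_nat_const card_ord mulnC.
  rewrite (bigD1 i0) //= [X in (_ < X)%N](bigD1 i0) //= -addSn leq_add //.
  by apply: leq_sum => i _; apply: ltnW.
pose m := qf A (row i0 V).
have m0 : 0 < m by apply: (proj2 pA); case: (Vm i0).
have Gm i j : `|(V *m A *m V^T) i j| <= m.
  have -> : (V *m A *m V^T) i j = (row i V *m A *m (row j V)^T) 0 0.
    rewrite -row_mul tr_row [LHS]mxE [RHS]mxE; apply: eq_bigr => k _.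
    by rewrite [row _ _ _ _]mxE [col _ _ _ _]mxE.
  have [v0 vm] := Vm i; apply: le_trans (minrow_form_le pA (Vm i) (Vm j)) _.
  by apply: vm; case: (Vm i0).
(* As [det V *: w = e *m V], the number [I ^ 2 * qf A w] is a sum of products [e_i e_j] times Gram
   entries bounded by [m]. With [sum |e_i| < I], the nonzero vector [w] would be shorter than the
   minimum. *)
have : m * I%:Z ^+ 2 <= m * (\sum_i `|e 0%R i|%N)%:Z ^+ 2.
  apply: le_trans (_ : qf A w * I%:Z ^+ 2 <= _).
    by rewrite ler_wpM2r // (proj2 (Vm i0)).
  rewrite mulrC abszE real_normK ?num_real // -qfZ.
  have -> : \det V *: w = e *m V by rewrite -we -mulmxA mul_adj_mx mul_mx_scalar.
  have -> : (\sum_i `|e 0%R i|)%N%:Z = \sum_i `|e 0 i| :> int.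
    by rewrite (big_morph Posz PoszD (erefl _)); apply: eq_bigr => i _; rewrite abszE.
  rewrite qf_mul qf_sum expr2 mulrA [m * _]mulrC !mulr_suml.
  apply: ler_sum => i _; rewrite mulr_sumr; apply: ler_sum => j _.
  by apply: le_trans (ler_norm _) _; rewrite !normrM ler_wpM2r // ler_wpM2l.
by rewrite ler_pM2l // ler_pXn2r ?nnegrE // lez_nat leqNgt sum_lt.
Qed.

(** Cramer's rule, by expansion along row [i]. *)
Lemma mul_adj_row (V : 'M[int]_d) x i :
  (x *m \adj V) 0 i = \det (\matrix_k (if k == i then x else row k V)).
Proof.
set W := (\matrix_k _); rewrite (expand_det_row W i) mxE.
apply: eq_bigr => j _; rewrite !mxE eqxx; congr (_ * (_ * \det _)).
apply/matrixP=> a b; rewrite !mxE eq_sym (negPf (neq_lift _ _)) mxE //.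
Qed.

(** Perfection writes the identity as a combination of tensors of minimal vectors, which therefore
    span. Their determinants are bounded by [d ^ d], so a maximal one exists. Replacing row [i] by
    [x] cannot enlarge it, and by Cramer's rule this bounds coordinate [i] of [x]. *)
Lemma maximal_minrows :
  perfmx A -> exists V : 'M[int]_d, [/\ forall i, minrow A (row i V), \det V != 0
    & forall x i, minrow A x -> (`|(x *m \adj V) 0%R i| <= `|\det V|)%N].
Proof.
move=> perfA.
have [V Vm V0] : exists2 V : 'M[int]_d, forall i, minrow A (row i V) & \det V != 0.
  have [l [lm l1]] := perfA 1%:M (trmx1 _ _).
  pose X := \matrix_(k < size l) map_mx intr (nth (0, 0) l k).2 : 'M[R]_(_, d).
  have fullX : row_full X.
    apply/row_fullP; exists (\matrix_(i < d, k < size l) ((nth (0, 0) l k).1 * X k i)).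
    apply/matrixP=> i j; rewrite l1 (big_nth (0, 0)) big_mkord summxE mxE.
    by apply: eq_bigr => k _; rewrite !mxE big_ord1 !mxE rmorphM /= mulrA.
  exists (\matrix_i (nth (0, 0) l (fullrankfun fullX i)).2).
    by move=> i; rewrite rowK; apply: lm; rewrite mem_nth.
  have := fullrowsub_unit fullX; rewrite unitmxE unitfE.
  set Y := rowsub _ _; set W := \matrix_i _.
  have -> : Y = map_mx intr W by apply/matrixP=> i j; rewrite !mxE.
  by rewrite det_map_mx intr_eq0.
have [n] := ubnP (d ^ d - `|\det V|)%N.
elim: n V Vm V0 => // n IH V Vm V0; rewrite ltnS => Vn.
case: (classic (exists2 W : 'M[int]_d, forall i, minrow A (row i W) & (`|\det V| < `|\det W|)%N)).
  move=> [W Wm VW]; have W0 : \det W != 0 by rewrite -absz_gt0 (leq_trans _ VW).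
  apply: (IH W) => //; have := index_minrows_le Wm W0; have := index_minrows_le Vm V0; lia.
move=> nW; exists V; split=> // x i xm; rewrite leqNgt; apply/negP=> lt.
apply: nW; exists (\matrix_k (if k == i then x else row k V)); last by rewrite -mul_adj_row.
by move=> k; rewrite rowK; case: ifP.
Qed.
End MaximalMinors.

(** * Lattice points in a box around the origin *)

Section BoxCount.
Variables (d : nat) (V : 'M[int]_d).
Hypothesis V0 : \det V != 0.

Definition in_box (I : nat) (y : 'rV[int]_d) : Prop := forall i, (`|y 0%R i| <= I)%N.

Lemma adj_inj x x' : x *m \adj V = x' *m \adj V -> x = x' :> 'rV[int]_d.
Proof.
move=> E; have : \det V *: x = \det V *: x'.
  by rewrite -!mul_mx_scalar -mul_adj_mx !mulmxA E.
by move=> {}E; apply/rowP=> i; move/rowP/(_ i): E; rewrite !mxE => /(mulfI V0).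
Qed.

(** With [y = x *m \adj V], the label of [y] consists of the class of [x] modulo the span of [V] and
    of the floors of [(y_i + I) / I], which are 0, 1 or 2. Two points with one class differ in
    scaled coordinates by a multiple of [det V]; with equal floors they differ by less than [I],
    hence not at all. *)
Lemma box_count (N : nat) : (`|\det V| <= N)%N ->
  exists g : 'rV[int]_d -> 'I_(N * 3 ^ d), forall x x',
    in_box `|\det V|%N (x *m \adj V) -> in_box `|\det V|%N (x' *m \adj V) ->
    g (x *m \adj V) = g (x' *m \adj V) -> x = x'.
Proof.
move=> VN; have [T [r [_ [cardT rP _]]]] := residue_classes V0.
pose I := `|\det V|%N; have I0 : (0 < I)%N by rewrite absz_gt0.
pose fl (y : 'rV[int]_d) := [ffun i => inord `|divz (y 0%R i + I%:Z) I%:Z|%N] : {ffun 'I_d -> 'I_3}.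
have card_le : (#|{: T * {ffun 'I_d -> 'I_3}}| <= N * 3 ^ d)%N.
  by rewrite card_prod card_ffun !card_ord cardT leq_mul2r VN orbT.
pose coord (y : 'rV[int]_d) : 'rV[int]_d := \row_i divz ((y *m V) 0 i) (\det V).
have coordK x : coord (x *m \adj V) = x.
  apply/rowP=> i; rewrite mxE -mulmxA mul_adj_mx mul_mx_scalar mxE mulrC.
  by rewrite mulzK.
exists (fun y => widen_ord card_le (enum_rank (r (coord y), fl y))) => x x' bx bx'.
move=> /(congr1 val) /= /val_inj /enum_rank_inj; rewrite !coordK => -[/rP[z xz] /ffunP flE].
have E : x *m \adj V - x' *m \adj V = \det V *: z.
  by rewrite -mulmxBl xz -mulmxA mul_mx_adj mul_mx_scalar.
apply: adj_inj; apply/eqP; rewrite -subr_eq0; apply/eqP/rowP => i; move/rowP/(_ i): E.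
move: (flE i) (bx i) (bx' i); rewrite !ffunE -/I.
have subE (a b : 'rV[int]_d) : (a - b) 0 i = a 0 i - b 0 i by rewrite !mxE.
have scaleE c (a : 'rV[int]_d) : (c *: a) 0 i = c * a 0 i by rewrite mxE.
rewrite !(subE, scaleE) [(0 : 'rV_d) 0 i]mxE.
move: ((x *m _) 0 i) ((x' *m _) 0 i) (z 0 i) => a b c /(congr1 val) /= flab ba bb E.
have rng u : (`|u| <= I)%N -> (`|divz (u + I%:Z) I%:Z|%N < 3)%N /\ 0 <= divz (u + I%:Z) I%:Z.
  move=> uI; have u0 : 0 <= u + I%:Z by lia.
  have u2 : u + I%:Z <= 2 * I%:Z by lia.
  have := divz_eq (u + I%:Z) I%:Z; have := modz_ge0 (u + I%:Z) (d := I%:Z); nia.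
have [ra ra0] := rng _ ba; have [rb rb0] := rng _ bb.
rewrite !inordK // in flab.
have := divz_eq (a + I%:Z) I%:Z; have := divz_eq (b + I%:Z) I%:Z.
have := ltz_mod (a + I%:Z) (d := I%:Z); have := ltz_mod (b + I%:Z) (d := I%:Z).
have := modz_ge0 (a + I%:Z) (d := I%:Z); have := modz_ge0 (b + I%:Z) (d := I%:Z).
have Idet : I%:Z = \det V \/ I%:Z = - \det V by rewrite /I; lia.
have I0' : I%:Z != 0 by lia.
move=> /(_ I0') h1 /(_ I0') h2 /(_ I0') h3 /(_ I0') h4 h5 h6.
have ab : a - b = modz (a + I%:Z) I%:Z - modz (b + I%:Z) I%:Z by nia.
have abI : (`|a - b| < I)%N by lia.
have [cz|c0] := eqVneq c 0; first by rewrite E cz mulr0.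
have : (I <= `|a - b|)%N by rewrite E abszM leq_pmulr // absz_gt0.
by rewrite leqNgt abI.
Qed.

(** For [G] congruent to [\adj V] modulo [I = |det V|], the group generated by the rows of [G] and
    by [I Z^d] is that of the rows of [\adj V], because [V *m \adj V] is the scalar [det V]. The
    description involves only [I] and [G], not [V]. *)
Definition in_code_box (I : nat) (G : 'M[int]_d) (y : 'rV[int]_d) : Prop :=
  in_box I y /\ exists x z, y = x *m G + I%:Z *: z.

Lemma absz_sgz (a : int) : `|a|%N%:Z = sgz a * a.
Proof. by rewrite -abszEsg abszE. Qed.

Lemma adj_mod_split (G : 'M[int]_d) :
  (forall i j, modz (\adj V i j) `|\det V|%N = G i j) ->
  exists Q, \adj V = G + Q *m V *m \adj V.
Proof.
move=> VG; exists (sgz (\det V) *: \matrix_(i, j) divz (\adj V i j) `|\det V|%N).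
rewrite -mulmxA mul_mx_adj mul_mx_scalar scalerA mulrC -absz_sgz.
set W := \matrix_(_, _) _; apply/matrixP=> i j.
have -> : (G + `|\det V|%N%:Z *: W) i j = G i j + `|\det V|%N%:Z * W i j by rewrite !mxE.
by rewrite -VG [W i j]mxE addrC mulrC; apply: divz_eq.
Qed.

Lemma in_code_boxE (G : 'M[int]_d) y :
  (forall i j, modz (\adj V i j) `|\det V|%N = G i j) ->
  in_code_box `|\det V|%N G y <-> in_box `|\det V|%N y /\ exists x, y = x *m \adj V.
Proof.
move=> /adj_mod_split[Q QE]; split=> -[yb]; last first.
  move=> [x yE]; split=> //; exists x, (sgz (\det V) *: (x *m Q)).
  rewrite {}yE absz_sgz scalerA mulrAC mulz_sg V0 mul1r.
  rewrite -mul_mx_scalar -mul_mx_adj -mulmxA.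
  by rewrite !mulmxA -[x *m Q *m V *m _]mulmxA -[x *m Q *m _]mulmxA -mulmxDr mulmxA -QE.
move=> [x [z yE]]; split=> //; rewrite {}yE.
have -> : G = \adj V - Q *m V *m \adj V by rewrite {1}QE addrK.
exists (x - x *m Q *m V + sgz (\det V) *: (z *m V)).
have -> : `|\det V|%N%:Z *: z = (sgz (\det V) *: (z *m V)) *m \adj V.
  by rewrite -scalemxAl -mulmxA mul_mx_adj mul_mx_scalar scalerA -absz_sgz.
by rewrite mulmxDl mulmxBl mulmxBr !mulmxA.
Qed.
End BoxCount.

(** The value of a quadratic form at [v] is a linear functional of the tensor of [v], so the
    determination of a form by its values becomes linear algebra. *)
Lemma qf_tensor d (E : 'M[int]_d) (v : 'rV[int]_d) :
  (mxvec (tensor v) *m (mxvec (map_mx intr E : 'M[R]_d))^T) 0 0 = (qf E v)%:~R.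
Proof.
have -> : tensor v = (map_mx intr v : 'rV[R]_d)^T *m map_mx intr v.
  by rewrite map_trmx -map_mxM.
rewrite mxvec_dotmul; have -> : (map_mx intr v : 'rV[R]_d)^T = map_mx intr v^T.
  by rewrite map_trmx.
by rewrite -!map_mxM mxE.
Qed.

(* The tensors of the minimal vectors live in a space of dimension [d * d], so
   that many of them already determine every quadratic form. *)
Lemma determining_minrows d (A : 'M[int]_d) : (0 < d)%N -> perfmx A ->
  exists2 xs : 'I_(d * d) -> 'rV[int]_d, forall k, minrow A (xs k)
    & forall E : 'M[int]_d, E^T = E -> (forall k, qf E (xs k) = 0) -> E = 0.
Proof.
move=> d_gt0 perfA.
have /fin_all_exists[ls lsP] (ab : 'I_d * 'I_d) : exists l : seq (R * 'rV[int]_d),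
    (forall p, p \in l -> minrow A p.2) /\
    delta_mx ab.1 ab.2 + delta_mx ab.2 ab.1 = \sum_(p <- l) p.1 *: tensor p.2.
  by apply: perfA; rewrite linearD /= !trmx_delta addrC.
pose vs := [seq p.2 | p <- flatten [seq ls ab | ab <- enum {: 'I_d * 'I_d}]].
have vs_min v : v \in vs -> minrow A v.
  by case/mapP=> p /flattenP[l /mapP[ab _ ->]] pl ->; case: (lsP ab) => /(_ p pl).
have mem_vs ab p : p \in ls ab -> p.2 \in vs.
  move=> pl; apply: map_f; apply/flattenP; exists (ls ab) => //.
  by apply: map_f; rewrite mem_enum.
pose T := \matrix_(k < size vs) mxvec (tensor (nth 0 vs k)).
have determine (E : 'M[int]_d) : E^T = E -> (forall v, v \in vs -> qf E v = 0) -> E = 0.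
  move=> sE Evs; apply/matrixP=> a b; rewrite [RHS]mxE.
  (* Pairing [E] with the symmetric matrix unit at [(a, b)] yields [E a b + E b a = 0]. *)
  have [lm lE] := lsP (a, b); move/(congr1 (fun S => mxvec S *m (mxvec (map_mx intr E))^T)): lE.
  rewrite linear_sum /= mulmx_suml big1_seq; last first.
    move=> p /= pl; rewrite linearZ -scalemxAl; apply/matrixP=> i j.
    by rewrite !ord1 mxE qf_tensor Evs ?mulr0 ?mxE // (mem_vs (a, b)).
  have dE i j : delta_mx i j = (delta_mx 0 i : 'rV[R]_d)^T *m delta_mx 0 j.
    by rewrite trmx_delta mul_delta_mx.
  rewrite !dE linearD mulmxDl !mxvec_dotmul -!rowE !trmx_delta -!colE.
  move/matrixP/(_ 0 0); rewrite !mxE; have -> : E b a = E a b by rewrite -[in LHS]sE mxE.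
  by rewrite -rmorphD /= => /eqP; rewrite intr_eq0; lia.
have r_le : (\rank T <= d * d)%N := rank_leq_col T.
have vs0 : (0 < size vs)%N.
  rewrite lt0n size_eq0; apply/eqP=> vsE; have E0 := determine 1%:M (trmx1 _ _).
  have /matrixP/(_ (Ordinal d_gt0) (Ordinal d_gt0)) : 1%:M = 0 :> 'M[int]_d.
    by apply: E0 => v; rewrite vsE.
  by rewrite !mxE eqxx.
(* A maximal independent set of rows of [T] may have fewer than [d * d] members; the remaining
   places repeat the first vector of [vs]. *)
pose f (k : 'I_(d * d)) : 'I_(size vs) :=
  if insub (k : nat) is Some k' then maxrankfun T k' else Ordinal vs0.
exists (fun k => nth 0 vs (f k)) => [k|E sE Ek]; first by apply: vs_min; rewrite mem_nth.
apply: determine => // v vvs; apply/eqP; rewrite -(intr_eq0 R) -qf_tensor; apply/eqP.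
pose e := (mxvec (map_mx intr E : 'M[R]_d))^T.
have Te : T *m e = 0.
  have /submxP[D ->] : (T <= rowsub (maxrankfun T) T)%MS by rewrite eq_maxrowsub.
  rewrite -mulmxA (_ : _ *m e = 0) ?mulmx0 //; apply/matrixP=> k j.
  rewrite ord1 mxE [RHS]mxE.
  have kd : (k < d * d)%N := leq_trans (ltn_ord k) r_le.
  have := Ek (Ordinal kd); rewrite /f /= valK => /(congr1 (fun z : int => z%:~R : R)).
  rewrite -qf_tensor mxE => E0; rewrite -[RHS]E0.
  by apply: eq_bigr => i _; rewrite !mxE.
have iv : (index v vs < size vs)%N by rewrite index_mem.
have : row (Ordinal iv) (T *m e) = 0 by rewrite Te row0.
by rewrite row_mul rowK /= nth_index // => ->; rewrite mxE.
Qed.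

(** The rows of both adjugates generate the group spanned by the rows of [G] and by [I Z^d], so
    [\adj V = U *m \adj V'] with [U] invertible. Passing to inverses gives [V' = V *m U] up to the
    sign of [det V / det V']. *)
Lemma adj_congr_equiv d (V V' G : 'M[int]_d) :
  \det V != 0 -> `|\det V|%N = `|\det V'|%N ->
  (forall i j, modz (\adj V i j) `|\det V|%N = G i j) ->
  (forall i j, modz (\adj V' i j) `|\det V'|%N = G i j) ->
  exists2 U, U \in unitmx & V' *m U = V \/ V' *m U = - V.
Proof.
move=> V0 VV' VG V'G; have V'0 : \det V' != 0 by rewrite -absz_eq0 -VV' absz_eq0.
have [Q QE] := adj_mod_split VG; have [Q' Q'E] := adj_mod_split V'G.
have key (W W' P P' : 'M[int]_d) : \det W != 0 -> \det W' != 0 ->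
    `|\det W|%N = `|\det W'|%N -> \adj W = G + P *m W *m \adj W ->
    \adj W' = G + P' *m W' *m \adj W' -> exists U, \adj W = U *m \adj W'.
  move=> W0 W'0 WW' PE P'E.
  exists (1%:M + (sgz (\det W) * sgz (\det W')) *: (P *m W') - P' *m W').
  rewrite mulmxBl mulmxDl mul1mx -scalemxAl -[P *m W' *m _]mulmxA mul_mx_adj.
  rewrite mul_mx_scalar scalerA {1}P'E addrAC addrK [LHS]PE -mulmxA mul_mx_adj mul_mx_scalar.
  congr (_ + _ *: _); rewrite -mulrA -absz_sgz -WW' absz_sgz mulrA mulz_sg W0 mul1r //.
have [U UE] := key V V' Q Q' V0 V'0 VV' QE Q'E.
have [U' U'E] := key V' V Q' Q V'0 V0 (esym VV') Q'E QE.
have UU' : U *m U' = 1%:M.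
  apply: (scale_cancel V0); rewrite -[LHS]mul_mx_scalar -mul_adj_mx !mulmxA.
  by rewrite -[U *m _ *m _]mulmxA -U'E -UE mul_adj_mx scalemx1.
have VUV' : V *m U *m \adj V' = (\det V)%:M by rewrite -mulmxA -UE mul_mx_adj.
have VU : \det V' *: (V *m U) = \det V *: V'.
  by rewrite -mul_mx_scalar -mul_adj_mx mulmxA VUV' mul_scalar_mx.
have uU : U \in unitmx by case/mulmx1_unit: UU'.
exists U'; first by case/mulmx1_unit: UU'.
have U'V : V' *m U' *m U = V' by rewrite -mulmxA (mulmx1C UU') mulmx1.
have {}VU : \det V' *: V = \det V *: (V' *m U').
  by rewrite scalemxAl -VU -scalemxAl -mulmxA UU' mulmx1.
have [E|E] : \det V' = \det V \/ \det V' = - \det V by lia.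
  by left; apply: (scale_cancel V0); rewrite -VU E.
by right; apply: (scale_cancel V0); rewrite -VU E scalerN scaleNr.
Qed.

Lemma isomx_prim d (A B : 'M[int]_d) : isomx A B -> primmx A -> primmx B.
Proof.
move=> /isomx_sym[P _ ->] pB g gB; apply: pB => i j; rewrite mxE rpred_sum // => k _.
by rewrite dvdz_mulr // mxE rpred_sum // => l _; rewrite dvdz_mull.
Qed.

(** After division by [gcd (a, b)], the coefficient of [A] divides all entries of [B], hence 1, and
    conversely. *)
Lemma proportional_prim d (A B : 'M[int]_d) (a b : int) :
  0 < a -> 0 < b -> primmx A -> primmx B -> a *: A = b *: B -> A = B.
Proof.
move=> a0 b0 pA pB AB.
have g0 : 0 < gcdz a b by rewrite lt0r gcdz_eq0 ?(gt_eqF a0).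
have dva := dvdz_gcdl a b; have dvb := dvdz_gcdr a b.
have [a' aE] := dvdzP dva; have [b' bE] := dvdzP dvb.
have cop : coprimez a' b'.
  apply/eqP; apply: (mulIf (lt0r_neq0 g0)); rewrite mul1r.
  have := mulz_gcdl a' b' (gcdz a b); rewrite -aE -bE => {2}<-.
  by rewrite gez0_abs ?ltW.
have AB' i j : a' * A i j = b' * B i j.
  apply: (mulIf (lt0r_neq0 g0)); rewrite !(mulrAC _ _ (gcdz a b)) -aE -bE.
  by have /matrixP/(_ i j) := AB; rewrite !mxE.
have a'1 : (a' %| 1)%Z.
  by apply: pB => i j; rewrite -(Gauss_dvdzr _ cop) -AB' dvdz_mulr.
have b'1 : (b' %| 1)%Z.
  by apply: pA => i j; rewrite -(@Gauss_dvdzr b' a') 1?coprimez_sym // AB' dvdz_mulr.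
have a'0 : 0 < a' by rewrite -(pmulr_lgt0 _ g0) -aE.
have b'0 : 0 < b' by rewrite -(pmulr_lgt0 _ g0) -bE.
have ab : a = b.
  rewrite [LHS]aE [RHS]bE; congr (_ * _); move: a'1 b'1; rewrite !dvdz1 => /eqP + /eqP.
  by move: a'0 b'0; clear; lia.
by apply: (@scale_cancel _ _ a); rewrite ?gt_eqF // AB ab.
Qed.

(** * Finite codes that determine a perfect form *)

Section Codes.
Variables (d N : nat).
Hypothesis d_gt0 : (0 < d)%N.
Let B := (N * 3 ^ d)%N.

Definition key_mx (g : {ffun 'I_d * 'I_d -> 'I_N.+1}) : 'M[int]_d :=
  \matrix_(i, j) (g (i, j) : nat)%:Z.

Definition box_injective (I : nat) (G : 'M[int]_d) (f : 'rV[int]_d -> 'I_B) : Prop :=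
  forall y y', in_code_box I G y -> in_code_box I G y' -> f y = f y' -> y = y'.

(** The labelling is chosen from [I] and [G] alone, so that two lattices with the same code use the
    same one; [f0] only shows that labellings exist. *)
Definition box_index (f0 : 'rV[int]_d -> 'I_B) I G :=
  ClassicalEpsilon.epsilon (inhabits f0) (box_injective I G).

Definition code_type : finType :=
  ('I_N.+1 * {ffun 'I_d * 'I_d -> 'I_N.+1} * {ffun 'I_(d * d) -> 'I_B})%type.

(** The code lists the index [I], the adjugate modulo [I], and the labels of [d * d] minimal vectors
    that determine every quadratic form. *)
Definition has_code f0 (A : 'M[int]_d) (c : code_type) : Prop :=
  exists (V : 'M[int]_d) (xs : 'I_(d * d) -> 'rV[int]_d),
    let I : nat := c.1.1 in let G := key_mx c.1.2 in
    [/\ \det V != 0, `|\det V|%N = I & forall i j, modz (\adj V i j) I = G i j] /\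
    [/\ forall k, minrow A (xs k), forall k, in_box I (xs k *m \adj V),
      forall k, box_index f0 I G (xs k *m \adj V) = c.2 k
    & forall E : 'M[int]_d, E^T = E -> (forall k, qf E (xs k) = 0) -> E = 0].

(** Equal labels force equal scaled coordinates of the chosen minimal vectors of both lattices.
    Rescaled to a common minimum, the two forms agree at these vectors, hence everywhere; a
    unimodular [U] relates [V] and [V'] up to sign, and primitivity removes the scale. *)
Lemma has_code_iso f0 A A' c : ppimx A -> ppimx A' ->
  has_code f0 A c -> has_code f0 A' c -> isomx A A'.
Proof.
move=> [pA prA perfA] [pA' prA' perfA'] [V [xs [[V0 VI VG] [xm xb xc xd]]]].
move=> [V' [xs' [[V'0 VI' VG'] [xm' xb' xc' _]]]].
set I : nat := c.1.1 in VI VG xb xc VI' VG' xb' xc'.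
set G := key_mx c.1.2 in VG xc VG' xc'.
have VV' : `|\det V|%N = `|\det V'|%N by rewrite VI.
rewrite -{1}VI in VG; rewrite -{1}VI' in VG'.
have [U uU UV] := adj_congr_equiv V0 VV' VG VG'.
have inj : box_injective I G (box_index f0 I G).
  apply: ClassicalEpsilon.epsilon_spec; have VN : (`|\det V| <= N)%N by rewrite VI -ltnS; apply: ltn_ord.
  have [g gP] := box_count V0 VN; exists g => y y'; rewrite -VI.
  move=> /(in_code_boxE V0 _ VG)[yb [x yx]] /(in_code_boxE V0 _ VG)[yb' [x' yx']].
  by rewrite yx yx' in yb yb' * => /gP -> //.
have xsE k : xs k *m \adj V = xs' k *m \adj V'.
  apply: inj; last by rewrite xc xc'.
    by rewrite -VI; apply/(in_code_boxE V0 _ VG); split; [rewrite VI | exists (xs k)].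
  by rewrite -VI'; apply/(in_code_boxE V'0 _ VG'); split; [rewrite VI' | exists (xs' k)].
pose k0 : 'I_(d * d) := Ordinal (leq_mul d_gt0 d_gt0).
pose m := qf A (xs k0); pose m' := qf A' (xs' k0).
have m0 : 0 < m by apply: (proj2 pA); case: (xm k0).
have m'0 : 0 < m' by apply: (proj2 pA'); case: (xm' k0).
have qm k : qf A (xs k) = m.
  by apply/eqP; rewrite eq_le (proj2 (xm k)) ?(proj2 (xm k0)) //; [case: (xm k) | case: (xm k0)].
have qm' k : qf A' (xs' k) = m'.
  by apply/eqP; rewrite eq_le (proj2 (xm' k)) ?(proj2 (xm' k0)) //; [case: (xm' k) | case: (xm' k0)].
(* The difference of the Gram matrices of the rows of [V] and of [V'], after scaling both lattices
   to minimum [m * m']. *)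
pose E := m' *: (V *m A *m V^T) - m *: (V' *m A' *m V'^T).
have sE : E^T = E.
  by rewrite /E linearB /= !linearZ /= !trmx_mul !trmxK (proj1 pA) (proj1 pA') !mulmxA.
have adjE (W : 'M[int]_d) (M : 'M[int]_d) x : qf M (x *m \adj W *m W) = \det W ^+ 2 * qf M x.
  by rewrite -mulmxA mul_adj_mx mul_mx_scalar qfZ.
have E0 : \adj V *m E *m (\adj V)^T = 0.
  apply: xd => [|k]; first by rewrite !trmx_mul trmxK sE mulmxA.
  rewrite -qf_mul /E.
  have qfB M M' x : qf (m' *: M - m *: M') x = m' * qf M x - m * qf M' x :> int.
    by rewrite /qf mulmxBr mulmxBl -!scalemxAr -!scalemxAl !mxE.
  rewrite qfB -!qf_mul adjE xsE adjE qm qm'.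
  have -> : \det V ^+ 2 = \det V' ^+ 2.
    have [->|->] : \det V = \det V' \/ \det V = - \det V' by lia.
    by [].
    by rewrite sqrrN.
  by ring.
have {}E0 : E = 0.
  apply: (scale_cancel V0); apply: (scale_cancel V0); rewrite !scaler0.
  transitivity (V *m (\adj V *m E *m (\adj V)^T) *m V^T); last by rewrite E0 mulmx0 mul0mx.
  rewrite !mulmxA mul_mx_adj -mulmxA -trmx_mul mul_mx_adj tr_scalar_mx.
  by rewrite mul_scalar_mx mul_mx_scalar.
have VE : V *m A *m V^T = V' *m (U *m A *m U^T) *m V'^T.
  transitivity ((V' *m U) *m A *m (V' *m U)^T); last by rewrite trmx_mul !mulmxA.
  by case: UV => ->; rewrite // linearN /= !mulNmx mulmxN opprK.
have AA' : m' *: (U *m A *m U^T) = m *: A'.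
  apply: (scale_cancel V'0); apply: (scale_cancel V'0).
  have sandwich M : \det V' *: (\det V' *: M) = \adj V' *m (V' *m M *m V'^T) *m (\adj V')^T.
    rewrite !mulmxA mul_adj_mx -mulmxA -trmx_mul mul_adj_mx tr_scalar_mx.
    by rewrite mul_scalar_mx mul_mx_scalar.
  rewrite !sandwich; congr (_ *m _ *m _).
  by rewrite -!scalemxAr -!scalemxAl -VE (subr0_eq E0).
have isoU : isomx A (U *m A *m U^T) by exists U^T; rewrite ?unitmx_tr ?trmxK.
by rewrite -(proportional_prim m'0 m0 (isomx_prim isoU prA) prA' AA').
Qed.

Lemma ppimx_has_code f0 A : (d ^ d <= N)%N -> ppimx A -> exists c, has_code f0 A c.
Proof.
move=> dN [pA prA perfA].
have [V [Vm V0 Vmax]] := maximal_minrows d_gt0 pA perfA.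
have [xs xm xd] := determining_minrows d_gt0 perfA.
have VN : (`|\det V| <= N)%N := leq_trans (index_minrows_le d_gt0 pA Vm V0) dN.
pose I := `|\det V|%N.
have adjP (ij : 'I_d * 'I_d) : (`|modz (\adj V ij.1 ij.2) I| < N.+1)%N.
  by have := @modz_ge0 (\adj V ij.1 ij.2) I; have := @ltz_mod (\adj V ij.1 ij.2) I; lia.
have IN : (I < N.+1)%N by rewrite ltnS.
pose g : {ffun 'I_d * 'I_d -> 'I_N.+1} := [ffun ij => Ordinal (adjP ij)].
exists (Ordinal IN, g, [ffun k => box_index f0 I (key_mx g) (xs k *m \adj V)]), V, xs => /=.
split; split=> //.
- by move=> i j; rewrite [RHS]mxE ffunE /=; have := @modz_ge0 (\adj V i j) I; lia.
- by move=> k i; apply: Vmax.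
- by move=> k; rewrite ffunE.
Qed.
End Codes.

Lemma perfect_class_count_le d : (0 < d)%N ->
  exists2 p, (p <= (d ^ d).+1 * (d ^ d).+1 ^ (d * d) * (d ^ d * 3 ^ d) ^ (d * d))%N
    & perfect_class_count d p.
Proof.
move=> d_gt0.
have B0 : (0 < d ^ d * 3 ^ d)%N by rewrite muln_gt0 !expn_gt0 d_gt0.
pose f0 : 'rV[int]_d -> 'I_(d ^ d * 3 ^ d) := fun _ => Ordinal B0.
have [||p pK pc] := @class_count_le d _ (has_code (N := d ^ d) f0).
- by move=> A pA; apply: ppimx_has_code.
- by move=> A A' c; apply: has_code_iso.
exists p => //; apply: leq_trans pK _.
by rewrite !card_prod !card_ffun card_prod !card_ord.
Qed.

(** * Lattices from binary codes *)

Definition mod2 m n (x : 'M[int]_(m, n)) : 'M['F_2]_(m, n) := map_mx intr x.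
(** Construction A for the code whose parity checks are the columns of [H]; the rows of [H]
    correspond to the positions. *)
Definition in_lat d K (H : 'M['F_2]_(d, K)) (x : 'rV[int]_d) : Prop := mod2 x *m H = 0.

Lemma F2_intr_eq0 (a : int) : (a%:~R == 0 :> 'F_2) = ~~ odd `|a|.
Proof.
have F2n n : (n%:R == 0 :> 'F_2) = ~~ odd n.
  by rewrite -(dvdn_pcharf (pchar_Fp (isT : prime 2))) dvdn2.
by case: a => n; rewrite ?NegzE ?mulrNz ?oppr_eq0 -pmulrn F2n ?abszN.
Qed.

Lemma F2_lift (a : 'F_2) : exists b : int, b%:~R = a.
Proof. by exists (a : nat)%:Z; rewrite -pmulrn natr_Zp. Qed.

Lemma mod2_lift m n (x : 'M['F_2]_(m, n)) : exists y, mod2 y = x.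
Proof.
have /fin_all_exists[y yP] (ij : 'I_m * 'I_n) := F2_lift (x ij.1 ij.2).
by exists (\matrix_(i, j) y (i, j)); apply/matrixP=> i j; rewrite !mxE yP.
Qed.

Lemma mod2_eq0 m n (x : 'M[int]_(m, n)) : mod2 x = 0 -> exists y, x = 2 *: y.
Proof.
move=> /matrixP x0; exists (\matrix_(i, j) divz (x i j) 2); apply/matrixP=> i j.
rewrite !mxE mulrC divzK // dvdzE /= dvdn2 -F2_intr_eq0.
by have := x0 i j; rewrite !mxE => ->.
Qed.

Lemma mod2D m n (x y : 'M[int]_(m, n)) : mod2 (x + y) = mod2 x + mod2 y.
Proof. exact: map_mxD. Qed.

Lemma mod2B m n (x y : 'M[int]_(m, n)) : mod2 (x - y) = mod2 x - mod2 y.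
Proof. exact: map_mxB. Qed.

Lemma mod2M m n p (x : 'M[int]_(m, n)) (y : 'M_(n, p)) : mod2 (x *m y) = mod2 x *m mod2 y.
Proof. exact: map_mxM. Qed.

Lemma mod2_double m n (x : 'M[int]_(m, n)) : mod2 (2 *: x) = 0.
Proof.
by apply/matrixP=> i j; rewrite !mxE; apply/eqP; rewrite F2_intr_eq0 abszM oddM.
Qed.

Section Basis.
Variables (d K : nat) (H : 'M['F_2]_(d, K)).

(** Lifts of the code words together with [2 Z^d] generate the lattice by [2 d] rows, and the Smith
    form compresses these to [d] rows. *)
Lemma in_lat_basis : exists2 B : 'M[int]_d, \det B != 0 &
  forall x, in_lat H x <-> exists z, x = z *m B.
Proof.
have [k kE] := mod2_lift (kermx H).
pose N : 'M[int]_(d + d, d) := col_mx k (2%:M).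
have latN x : in_lat H x <-> exists z, x = z *m N.
  split=> [xH|[z ->]].
    have /submxP[c cE] : (mod2 x <= kermx H)%MS by apply/sub_kermxP.
    have [c' c'E] := mod2_lift c.
    have [|y yE] := @mod2_eq0 _ _ (x - c' *m k).
      by rewrite mod2B mod2M c'E kE cE subrr.
    by exists (row_mx c' y); rewrite mul_row_col mul_mx_scalar -yE addrC subrK.
  rewrite -[z]hsubmxK mul_row_col mul_mx_scalar /in_lat mod2D mod2M kE mod2_double.
  by rewrite addr0 -mulmxA mulmx_ker mulmx0.
have [L uL [Q uQ [ds _ NE]]] := int_Smith_normal_form N.
pose D : 'M[int]_d := diag_mx (\row_i ds`_i).
have DE : \matrix_(i, j) (ds`_i *+ (i == j :> nat)) = col_mx D 0 :> 'M[int]_(d + d, d).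
  apply/matrixP=> i j; rewrite mxE -[i]splitK; case: (split i) => i' /=.
    by rewrite col_mxEu !mxE.
  by rewrite col_mxEd mxE gtn_eqF // ltn_addr.
rewrite DE in NE.
have latB x : in_lat H x <-> exists z, x = z *m (D *m Q).
  rewrite latN; split=> -[z ->].
    exists (lsubmx (z *m L)); rewrite NE !mulmxA -{1}[z *m L]hsubmxK mul_row_col.
    by rewrite mulmx0 addr0.
  exists (row_mx z 0 *m invmx L).
  by rewrite NE !mulmxA mulmxKV // mul_row_col mul0mx addr0.
exists (D *m Q) => //.
(* The vectors [2 e_i] lie in the span of [D *m Q], so its determinant divides [2 ^ d] and is not
   zero. *)
have /fin_all_exists[T TP] (i : 'I_d) : exists z, 2 *: delta_mx 0 i = z *m (D *m Q) :> 'rV_d.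
  apply/latB; by rewrite /in_lat mod2_double mul0mx.
have : (\matrix_i T i) *m (D *m Q) = 2%:M.
  apply/row_matrixP=> i; rewrite row_mul rowK -TP -scalemx1 linearZ /= rowE mulmx1 //.
move/(congr1 determinant); rewrite det_mulmx det_scalar => E.
apply/eqP=> D0; move: E; rewrite D0 mulr0 => /esym/eqP; rewrite expf_eq0 andbF //.
Qed.
End Basis.

Lemma F2_oppmx m n (x : 'M['F_2]_(m, n)) : - x = x.
Proof.
apply/matrixP=> i j; rewrite mxE; case: (x i j) => -[|[|k]] //= lk; exact: val_inj.
Qed.

Definition nsq d (v : 'rV[int]_d) : int := \sum_i v 0 i ^+ 2.

Definition row_quad d K (H : 'M['F_2]_(d, K)) (a b c e : 'I_d) : Prop :=
  uniq [:: a; b; c; e] /\ row a H + row b H + row c H + row e H = 0.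

(* The code with parity-check matrix [H^T] has even words only and minimal
   distance 4; any two positions lie in a word of weight 4, and no set of four
   positions meets all words of weight 4 in even cardinality. *)
Definition good_check d K (H : 'M['F_2]_(d, K)) : Prop :=
  [/\ exists u : 'cV_K, H *m u = const_mx 1,
      injective (fun i => row i H),
      forall a b, a != b -> exists c e, row_quad H a b c e
    & forall (W : {set 'I_d}) a, (#|W| <= 4)%N -> a \in W ->
        exists b c e, [/\ row_quad H a b c e, b \notin W, c \notin W & e \notin W]].

(** For [s] and [t] equal to 1 or -1 this lifts a word of weight 4 to a vector of norm 4. Two free
    signs suffice to isolate the product of the coordinates [a] and [b] by averaging. *)
Definition quad_vec d (R : pzRingType) (a b c e : 'I_d) (s t : R) : 'rV[R]_d :=
  delta_mx 0 a + delta_mx 0 b + s *: delta_mx 0 c + t *: delta_mx 0 e.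

(** * Norms in the lattice of a code *)

Section ConstructionA.
Variables (d K : nat) (H : 'M['F_2]_(d, K)).

Lemma row_mul_sum (x : 'rV['F_2]_d) : x *m H = \sum_(i | x 0 i != 0) row i H.
Proof.
rewrite mulmx_sum_row [RHS]big_mkcond /=; apply: eq_bigr => i _.
case: eqP => [->|/eqP]; first by rewrite scale0r.
have : x 0 i = 0 \/ x 0 i = 1.
  by case: (x 0 i) => -[|[|k]] //= lk; [left|right]; apply: val_inj.
by case=> ->; rewrite ?eqxx // scale1r.
Qed.

Lemma double_in_lat x : in_lat H (2 *: x).
Proof. by rewrite /in_lat mod2_double mul0mx. Qed.

Lemma quad_vec_in_lat a b c e s t : row_quad H a b c e -> odd `|s| -> odd `|t| ->
  in_lat H (quad_vec a b c e s t).
Proof.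
move=> [_ abce] os ot; rewrite /in_lat /quad_vec /mod2 !map_mxD !map_mxZ !map_delta_mx.
have oddE (r : int) : odd `|r| -> r%:~R = 1 :> 'F_2.
  move=> rodd; have : r%:~R != 0 :> 'F_2 by rewrite F2_intr_eq0 negbK.
  by case: (r%:~R : 'F_2) => -[|[|k]] //= lk _; apply: val_inj.
by rewrite /= !oddE // !scale1r !mulmxDl -!rowE.
Qed.

Lemma nsq_quad_vec (a b c e : 'I_d) (s t : int) : uniq [:: a; b; c; e] ->
  s ^+ 2 = 1 -> t ^+ 2 = 1 -> nsq (quad_vec a b c e s t) = 4.
Proof.
rewrite /= !inE !negb_or -!andbA => /and5P[ab ac ae bc /and3P[be ce _]] s2 t2.
have E i : quad_vec a b c e s t 0 i ^+ 2
  = (i == a)%:R + (i == b)%:R + (i == c)%:R + (i == e)%:R.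
  rewrite /quad_vec !mxE /=.
  have simp := (mulr0, mulr1, addr0, add0r, expr1n, expr0n, s2, t2).
  case: (eqVneq i a) => [->|ia]; first by rewrite (negPf ab) (negPf ac) (negPf ae) !simp.
  case: (eqVneq i b) => [->|ib]; first by rewrite (negPf bc) (negPf be) !simp.
  case: (eqVneq i c) => [->|ic]; first by rewrite (negPf ce) !simp.
  by case: (eqVneq i e) => _; rewrite !simp.
have one (j : 'I_d) : \sum_i (i == j)%:R = 1 :> int.
  by rewrite (bigD1 j) //= eqxx big1 ?addr0 // => i /negPf->.
by rewrite /nsq (eq_bigr _ (fun i _ => E i)) !big_split /= !one.
Qed.

Lemma nsq_double_delta (i : 'I_d) : nsq (2 *: delta_mx 0 i) = 4.
Proof.
rewrite /nsq (bigD1 i) //= big1 ?mxE ?eqxx // => j ji.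
by rewrite !mxE (negPf ji) andbF mulr0.
Qed.

Lemma nsq_small (v : 'rV[int]_d) : (forall i, (`|v 0%R i| <= 1)%N) ->
  nsq v = #|[set i | v 0 i != 0]|%:Z.
Proof.
move=> v1; rewrite /nsq -sum1_card (big_morph Posz PoszD (erefl _)).
rewrite [RHS](eq_bigl (fun i => v 0 i != 0)) => [|i]; last by rewrite inE.
rewrite [RHS]big_mkcond /=; apply: eq_bigr => i _; have := v1 i.
by move: (v 0 i) => w w1; have [->|[->|->]] : w = 0 \/ w = 1 \/ w = -1 by lia.
Qed.

Lemma nsq_ge_entry (v : 'rV[int]_d) i : v 0 i ^+ 2 <= nsq v.
Proof. by rewrite /nsq (bigD1 i) //= lerDl sumr_ge0 // => j _; apply: sqr_ge0. Qed.

Hypothesis goodH : good_check H.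

(** An entry of absolute value at least 2 already contributes 4. Otherwise the norm is the weight of
    a nonzero word: even because of [u], and not 2 because the rows of [H] are distinct. *)
Lemma min_lat (v : 'rV[int]_d) : in_lat H v -> v != 0 -> 4 <= nsq v.
Proof.
move=> vL v0; have [[u uH] injH _ _] := goodH.
case: (classic (exists i, (2 <= `|v 0%R i|)%N)) => [[i vi]|small].
  by apply: le_trans (nsq_ge_entry v i); rewrite -[_ ^+ 2]real_normK ?num_real //; nia.
have v1 i : (`|v 0%R i| <= 1)%N.
  by rewrite leqNgt; apply/negP=> vi; apply: small; exists i.
rewrite (nsq_small v1); set W := [set i | _].
have rW : \sum_(i in W) row i H = 0.
  rewrite -[RHS]vL row_mul_sum; apply: eq_bigl => i; rewrite inE mxE F2_intr_eq0 negbK.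
  by have := v1 i; case: (v 0 i) => -[|[|k]].
have evenW : ~~ odd #|W|.
  rewrite -[odd _]/(odd `|#|W|%:Z|) -F2_intr_eq0 -pmulrn; apply/eqP.
  have := congr1 (fun r => (r *m u) 0 0) rW; rewrite mul0mx mulmx_suml summxE mxE => <-.
  rewrite -sum1_card natr_sum; apply: eq_bigr => i _.
  by rewrite -row_mul uH !mxE.
have W0 : #|W| != 0%N.
  apply: contraNneq v0 => /eqP; rewrite cards_eq0 => /eqP W0; apply/eqP/rowP => i.
  by have : i \notin W; [rewrite W0 inE | rewrite inE negbK => /eqP->; rewrite mxE].
have W2 : #|W| != 2%N.
  apply/eqP=> W2; have /cards2P[i [j [ij WE]]] : #|W| == 2%N by rewrite W2.
  rewrite WE big_setU1 ?inE // big_set1 in rW.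
  move: ij; rewrite (injH i j) ?eqxx //.
  by apply/eqP; rewrite -[row j H]F2_oppmx -addr_eq0 rW.
rewrite lez_nat; move: evenW W0 W2; case: #|W| => [|[|[|[|n]]]] //.
Qed.
End ConstructionA.

Lemma quad_vec1 d (a b c e j : 'I_d) : uniq [:: a; b; c; e] ->
  quad_vec a b c e (1 : int) (1 : int) 0%R j = (j \in [:: a; b; c; e])%:R.
Proof.
rewrite /= !inE !negb_or -!andbA => /and5P[ab ac ae bc /and3P[be ce _]].
rewrite /quad_vec !scale1r !mxE /=.
case: (eqVneq j a) => [->|_]; first by rewrite (negPf ab) (negPf ac) (negPf ae).
case: (eqVneq j b) => [->|_]; first by rewrite (negPf bc) (negPf be).
by case: (eqVneq j c) => [->|_]; rewrite ?(negPf ce) //; case: (j == e).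
Qed.

(** * Perfection of the lattice of a good code *)

Section Perfection.
Variables (d K : nat) (H : 'M['F_2]_(d, K)).
Hypothesis goodH : good_check H.

Definition representable (S : 'M[R]_d) : Prop :=
  exists l : seq (R * 'rV[int]_d),
    (forall p, p \in l -> in_lat H p.2 /\ nsq p.2 = 4) /\ S = \sum_(p <- l) p.1 *: tensor p.2.

Lemma representable0 : representable 0.
Proof. by exists [::]; rewrite big_nil. Qed.

Lemma representableD S T : representable S -> representable T -> representable (S + T).
Proof.
move=> [l [lP ->]] [k [kP ->]]; exists (l ++ k); rewrite big_cat; split=> // p.
by rewrite mem_cat => /orP[/lP|/kP].
Qed.

Lemma representableZ c S : representable S -> representable (c *: S).
Proof.
move=> [l [lP ->]]; exists [seq (c * p.1, p.2) | p <- l]; split.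
  by move=> p /mapP[q /lP qP ->].
by rewrite big_map scaler_sumr; apply: eq_bigr => p _; rewrite scalerA.
Qed.

Lemma representable_tensor v : in_lat H v -> nsq v = 4 -> representable (tensor v).
Proof.
by move=> vL v4; exists [:: (1, v)]; rewrite big_seq1 scale1r; split=> // p /[!inE] /eqP->.
Qed.

Lemma representable_diag (a : 'I_d) : representable (delta_mx a a).
Proof.
have -> : delta_mx a a = 4^-1 *: tensor (2 *: delta_mx 0 a : 'rV[int]_d).
  apply/matrixP=> i j; rewrite !mxE big_ord1 !mxE /= rmorphM /= !rmorphM /=.
  by do 2![case: eqP => _ /=]; field.
by apply/representableZ/representable_tensor; [apply: double_in_lat | apply: nsq_double_delta].
Qed.

Lemma tensor_quad_vec a b c e s t :
  tensor (quad_vec a b c e s t : 'rV[int]_d)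
  = (quad_vec a b c e s%:~R t%:~R)^T *m (quad_vec a b c e s%:~R t%:~R).
Proof.
rewrite /tensor map_mxM -map_trmx.
have -> // : map_mx intr (quad_vec a b c e s t) = quad_vec a b c e s%:~R t%:~R :> 'rV[R]_d.
by rewrite /quad_vec !map_mxD !map_mxZ !map_delta_mx.
Qed.

(* Averaging over the signs of [c] and [e] kills all products except the one of [a] and [b]. *)
Lemma representable_pair (a b : 'I_d) : representable (delta_mx a b + delta_mx b a).
Proof.
have [ab|ab] := eqVneq a b.
  by rewrite ab; apply: representableD; apply: representable_diag.
have [_ _ /(_ a b ab)[c [e abce]] _] := goodH.
pose q s t := tensor (quad_vec a b c e s t : 'rV[int]_d).
have qrep s t : s ^+ 2 = 1 -> t ^+ 2 = 1 -> odd `|s| -> odd `|t| -> representable (q s t).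
  move=> s2 t2 os ot; apply: representable_tensor; first exact: quad_vec_in_lat.
  by apply: nsq_quad_vec => //; case: abce.
have -> : delta_mx a b + delta_mx b a = 4^-1 *: (q 1 1 + q 1 (-1) + q (-1) 1 + q (-1) (-1))
   + (-1) *: (delta_mx a a + delta_mx b b + delta_mx c c + delta_mx e e).
  rewrite /q !tensor_quad_vec; apply/matrixP=> i j; rewrite !mxE !big_ord1 !mxE /=.
  rewrite !rmorphN !rmorph1 /= -!mulnb !natrM.
  by field.
by do ![apply: representableD | apply: representableZ | apply: qrep | apply: representable_diag].
Qed.

Lemma representable_sym (S : 'M[R]_d) : S^T = S -> representable S.
Proof.
move=> sS; have -> : S = \sum_a \sum_b (S a b / 2) *: (delta_mx a b + delta_mx b a).
  under eq_bigr => a _ do under eq_bigr => b _ do rewrite scalerDr.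
  under eq_bigr => a _ do rewrite big_split.
  rewrite big_split /= [X in _ + X]exchange_big /= -big_split /= {1}[S]matrix_sum_delta.
  apply: eq_bigr => a _; rewrite -big_split; apply: eq_bigr => b _ /=.
  rewrite -scalerDl; congr (_ *: _); have -> : S b a = S a b by rewrite -[in LHS]sS mxE.
  by field.
elim/big_rec: _ => [|a T _ rT]; first exact: representable0.
apply: representableD rT; elim/big_rec: _ => [|b T' _ rT']; first exact: representable0.
by apply: representableD rT'; apply/representableZ/representable_pair.
Qed.
End Perfection.

Section Gram.
Variables (d K : nat) (H : 'M['F_2]_(d, K)) (B : 'M[int]_d).
Hypotheses (d_gt0 : (0 < d)%N) (goodH : good_check H) (B0 : \det B != 0).
Hypothesis latB : forall x, in_lat H x <-> exists z, x = z *m B.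

Lemma qf_gram x : qf (B *m B^T) x = nsq (x *m B).
Proof.
rewrite /qf /nsq !mulmxA -mulmxA -trmx_mul mxE; apply: eq_bigr => i _.
by rewrite [_^T _ _]mxE expr2.
Qed.

Lemma mul_basis_neq0 x : x != 0 -> x *m B != 0 :> 'rV[int]_d.
Proof.
apply: contraNneq => xB; apply/eqP/(scale_cancel B0).
by rewrite scaler0 -mul_mx_scalar -mul_mx_adj mulmxA xB mul0mx.
Qed.

Lemma basis_in_lat x : in_lat H (x *m B).
Proof. by apply/latB; exists x. Qed.

Lemma gram_ppimx : ppimx (B *m B^T).
Proof.
have B_R : (map_mx intr B : 'M[R]_d) \in unitmx by rewrite unitmxE det_map_mx unitfE intr_eq0.
split.
- split; first by rewrite trmx_mul trmxK.
  move=> x x0; rewrite qf_gram.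
  by apply: lt_le_trans (min_lat goodH (basis_in_lat x) (mul_basis_neq0 x0)).
(* Two words of weight 4 that meet only in position [a] lift to lattice vectors with scalar product
   1. *)
- move=> g gA; have [_ _ _ rig] := goodH; pose a := Ordinal d_gt0.
  have [||b [c [e [abce _ _ _]]]] := rig [set a] a; rewrite ?cards1 ?inE //.
  have [||b' [c' [e' [abce' b'W c'W e'W]]]] := rig [set a; b; c; e] a.
  + by rewrite !cardsU !cards1; lia.
  + by rewrite !inE eqxx.
  have /latB[x xE] := quad_vec_in_lat abce (isT : odd `|1|) (isT : odd `|1|).
  have /latB[x' x'E] := quad_vec_in_lat abce' (isT : odd `|1|) (isT : odd `|1|).
  pose p : int := (x *m (B *m B^T) *m x'^T) 0 0.
  have : (g %| p)%Z.
    rewrite /p mxE rpred_sum // => j _; rewrite dvdz_mulr // mxE.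
    by rewrite rpred_sum // => i _; rewrite dvdz_mull.
  rewrite /p !mulmxA -mulmxA -trmx_mul -xE -x'E mxE (bigD1 a) //= big1 ?addr0.
    by rewrite [_^T _ _]mxE !quad_vec1 ?(proj1 abce) ?(proj1 abce') // !inE eqxx.
  move=> j ja; rewrite [_^T _ _]mxE !quad_vec1 ?(proj1 abce) ?(proj1 abce') // !inE (negPf ja) /=.
  case: (boolP (j \in [set a; b; c; e])) => jW; last first.
    by move: jW; rewrite !inE (negPf ja) /= -orbA => /negPf->; rewrite mul0r.
  suff -> : [|| j == b', j == c' | j == e'] = false by rewrite mulr0.
  by apply/negbTE/negP => /or3P[]/eqP jE; move: jW; rewrite jE (negPf b'W, negPf c'W, negPf e'W).
(* Congruence with [B] carries tensors of coordinate vectors to tensors of lattice vectors, so a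
   representation of [BR^T *m S *m BR] pulls back to one of [S]. *)
- move=> S sS; pose BR := map_mx intr B : 'M[R]_d.
  have [|l [lP lE]] := representable_sym goodH (S := BR^T *m S *m BR).
    by rewrite !trmx_mul trmxK sS mulmxA.
  pose co (u : 'rV[int]_d) : 'rV[int]_d := \row_i divz ((u *m \adj B) 0 i) (\det B).
  have coK z : co (z *m B) = z.
    by apply/rowP=> i; rewrite mxE -mulmxA mul_mx_adj mul_mx_scalar mxE mulrC mulzK.
  exists [seq (p.1, co p.2) | p <- l]; split.
    move=> p /mapP[q /lP[/latB[z qz] q4] ->] /=; rewrite qz coK in q4 *; split.
      by apply: contra_eq_neq q4 => ->; rewrite mul0mx /nsq big1 // => i _; rewrite mxE.
    by move=> x x0; rewrite !qf_gram q4; apply: min_lat (basis_in_lat x) (mul_basis_neq0 x0).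
  have -> : S = (invmx BR)^T *m (BR^T *m S *m BR) *m invmx BR.
    by rewrite !mulmxA -trmx_mul mulmxV // trmx1 mul1mx mulmxK.
  rewrite lE mulmx_sumr mulmx_suml big_map big_seq [RHS]big_seq; apply: eq_bigr => p /lP[/latB[z pz] _].
  rewrite /= pz coK -scalemxAr -scalemxAl; congr (_ *: _).
  have tE : tensor (z *m B) = BR^T *m tensor z *m BR.
    by rewrite /tensor trmx_mul -mulmxA !map_mxM map_trmx !mulmxA.
  by rewrite tE !mulmxA -trmx_mul mulmxV // trmx1 mul1mx mulmxK.
Qed.
End Gram.

(** Evenness of the scalar products singles out the vectors [2 e_i] up to sign. Any other vector of
    norm 4 has entries 1 or -1 on a support of four positions; a word of weight 4 meeting that
    support in one position gives an odd scalar product. *)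
Lemma frame_vector d K (H : 'M['F_2]_(d, K)) (f : 'rV[int]_d) : good_check H ->
  in_lat H f -> nsq f = 4 ->
  (forall x, in_lat H x -> exists k, (f *m x^T) 0 0 = 2 * k) ->
  exists i s, s ^+ 2 = 1 /\ f = (2 * s) *: delta_mx 0 i.
Proof.
move=> [_ _ _ rig] fL f4 feven.
case: (classic (exists i, (2 <= `|f 0%R i|)%N)) => [[i fi]|small].
  have fi4 : f 0 i ^+ 2 = 4.
    apply/eqP; rewrite eq_le -{1}f4 nsq_ge_entry -[_ ^+ 2]real_normK ?num_real //; nia.
  have f0 j : j != i -> f 0 j = 0.
    move=> ji; apply/eqP; rewrite -sqrf_eq0; move: f4.
    rewrite /nsq (bigD1 i) //= fi4 (bigD1 j) //= => f4; rewrite eq_le sqr_ge0 andbT.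
    move/eqP: f4; rewrite -subr_eq0 addrAC subrr add0r => /eqP f4.
    by rewrite -[leRHS]f4 lerDl sumr_ge0 // => k _; apply: sqr_ge0.
  exists i, (divz (f 0 i) 2).
  have [fE|fE] : f 0 i = 2 \/ f 0 i = -2 by nia.
    rewrite fE; split=> //; apply/rowP=> j; rewrite !mxE /=.
    by case: eqVneq => [->|/f0->]; rewrite ?fE ?mulr1 ?mulr0.
  rewrite fE; split=> //; apply/rowP=> j; rewrite !mxE /=.
  by case: eqVneq => [->|/f0->]; rewrite ?fE ?mulr1 ?mulr0.
have f1 i : (`|f 0%R i| <= 1)%N.
  by rewrite leqNgt; apply/negP=> vi; apply: small; exists i.
have := nsq_small f1; rewrite f4; set W := [set i | _] => -[W4].
have /card_gt0P[a aW] : (0 < #|W|)%N by rewrite -W4.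
have [|b [c [e [abce bW cW eW]]]] := rig W a _ aW; first by rewrite -W4.
have [k] := feven _ (quad_vec_in_lat abce (isT : odd `|1|) (isT : odd `|1|)).
rewrite mxE (bigD1 a) //= big1 ?addr0 => [|j ja].
  rewrite mxE quad_vec1 ?inE ?eqxx ?mulr1; last by case: abce.
  by move: aW; rewrite inE => fa; have := f1 a; lia.
rewrite mxE quad_vec1; last by case: abce.
rewrite !inE (negPf ja) /=; case: (boolP (j \in W)) => jW; last first.
  by move: jW; rewrite inE negbK => /eqP->; rewrite mul0r.
suff -> : [|| j == b, j == c | j == e] = false by rewrite mulr0.
by apply/negbTE/negP => /or3P[]/eqP jE; move: jW; rewrite jE (negPf bW, negPf cW, negPf eW).
Qed.

(** A linear map that vanishes on the kernel of [H] factors through [H]. *)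
Lemma check_rows_equiv d K (H H' : 'M['F_2]_(d, K)) :
  (forall x, x *m H = 0 -> x *m H' = 0 :> 'rV_K) -> exists M, H' = H *m M.
Proof.
move=> HH'; have /submxP[D DE] : (H'^T <= H^T)%MS.
  rewrite submxE; apply/eqP/trmx_inj; rewrite trmx_mul trmxK trmx0.
  apply/row_matrixP=> i; rewrite row_mul row0; apply: HH'.
  apply: trmx_inj; rewrite trmx_mul trmx0 tr_row trmxK.
  by rewrite colE mulmxA mulmx_coker mul0mx.
by exists D^T; rewrite -[H']trmxK DE trmx_mul trmxK.
Qed.

(** * Isometries between lattices of codes *)

Section Isometry.
Variables (d K : nat) (H H' : 'M['F_2]_(d, K)) (B B' : 'M[int]_d).
Hypothesis goodH : good_check H.
Hypothesis latB : forall x, in_lat H x <-> exists z, x = z *m B.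
Hypothesis latB' : forall x, in_lat H' x <-> exists z, x = z *m B'.

(** The isometry sends each [2 e_i] to a vector of norm 4 with even scalar products, that is, to
    some [2 e_j] up to sign. It is thus a signed permutation; signs vanish modulo 2, so it permutes
    the positions of one code into those of the other. *)
Lemma iso_check_equiv : isomx (B *m B^T) (B' *m B'^T) ->
  exists (p : 'S_d) M, forall i, row i H' = row (p i) H *m M.
Proof.
move=> [P uP PE].
have uPt : P^T \in unitmx by rewrite unitmx_tr.
have /fin_all_exists[t tP] (i : 'I_d) : exists z, 2 *: delta_mx 0 i = z *m B' :> 'rV[int]_d.
  by apply/latB'; apply: double_in_lat.
pose T := \matrix_i t i; have TB' : T *m B' = 2%:M.
  by apply/row_matrixP=> i; rewrite row_mul rowK -tP -scalemx1 linearZ /= rowE mulmx1.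
pose F := T *m P^T *m B.
have FL i : in_lat H (row i F) by apply/latB; exists (row i (T *m P^T)); rewrite /F row_mul.
(* Here [x'] is the preimage of [x] under the isometry, and [F] holds the images of the [2 e_i]:
   scalar products are preserved, so those of [x] with the rows of [F] are twice the coordinates of
   [x']. *)
have transfer x : in_lat H x -> exists2 x', in_lat H' x' & F *m x^T = 2 *: x'^T.
  move=> /latB[z ->]; exists (z *m invmx P^T *m B').
    by apply/latB'; eexists.
  rewrite -mul_scalar_mx -TB' !trmx_mul trmx_inv trmxK /F.
  rewrite -[T *m B' *m _]mulmxA [B' *m _]mulmxA PE !mulmxA.
  by rewrite -[_ *m P *m invmx P]mulmxA mulmxV // mulmx1.
have FF : F *m F^T = 4%:M.
  rewrite /F !trmx_mul trmxK -!mulmxA [B *m (B^T *m _)]mulmxA.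
  rewrite [_ *m (P *m T^T)]mulmxA [P^T *m _]mulmxA [P^T *m _]mulmxA -PE.
  rewrite !mulmxA TB' -mulmxA -trmx_mul TB' tr_scalar_mx -scalar_mxM //.
have FFij i j : (row i F *m (row j F)^T) 0 0 = 4 *+ (i == j).
  have /matrixP/(_ i j) := FF; rewrite mxE [RHS]mxE => <-.
  by rewrite mxE; apply: eq_bigr => k _; rewrite !mxE.
have /fin_all_exists[p pP] (i : 'I_d) : exists j, exists s, s ^+ 2 = 1 /\ row i F = (2 * s) *: delta_mx 0 j.
  apply: frame_vector goodH (FL i) _ _.
    have := FFij i i; rewrite eqxx mulr1n mxE /nsq => <-; apply: eq_bigr => k _.
    by rewrite [_^T _ _]mxE expr2.
  move=> x /transfer[x' _ Fx]; exists (x' 0 i).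
  rewrite -row_mul Fx !mxE //.
have pinj : injective p.
  (* Distinct rows of [F] are orthogonal, whereas nonzero multiples of one unit vector are not. *)
  move=> i j pij; apply: contraTeq isT => ij.
  have := FFij i j; rewrite (negPf ij) /=.
  have [s [s2 ->]] := pP i; have [s' [s'2 ->]] := pP j; rewrite -pij.
  rewrite linearZ /= -scalemxAl -scalemxAr trmx_delta mul_delta_mx !mxE eqxx !mulr1.
  by move: s2 s'2; rewrite !expr2; nia.
pose q : 'S_d := perm pinj.
have [M ME] : exists M, row_perm q^-1 H' = H *m M.
  apply: check_rows_equiv => x xH; have [y yE] := mod2_lift x.
  have /transfer[y' y'L Fy] : in_lat H y by rewrite /in_lat yE.
  have xq : mod2 y' = col_perm q x.
    apply/rowP=> i; rewrite !mxE permE -yE mxE.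
    have := congr1 (fun w : 'cV[int]_d => w i 0) Fy; rewrite /= [RHS]mxE [y'^T _ _]mxE.
    have -> : (F *m y^T) i 0 = (row i F *m y^T) 0 0 by rewrite -row_mul [RHS]mxE.
    have [s [s2 ->]] := pP i; rewrite -scalemxAl -rowE !mxE -mulrA => E.
    have {E} <- : s * y 0 (p i) = y' 0 i by move: E; lia.
    apply/eqP; rewrite -subr_eq0 -rmorphB /= F2_intr_eq0.
    have [->|->] : s = 1 \/ s = -1 by nia.
      by rewrite mul1r subrr.
    by rewrite (_ : -1 * _ - _ = 2 * - y 0 (p i)) ?abszM ?oddM //; ring.
  by rewrite -y'L xq col_permE row_permE mulmxA.
exists q, M => i; rewrite -row_mul -ME; apply/rowP=> k; rewrite !mxE permK //.
Qed.
End Isometry.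

(** * Families of codes *)

Definition set_quad K (S : {set 'rV['F_2]_K}) (a b c e : 'rV['F_2]_K) : Prop :=
  [/\ uniq [:: a; b; c; e], b \in S, c \in S, e \in S & a + b + c + e = 0].

(** The conditions of [good_check] on the set of rows, free of any numbering of the positions. *)
Definition good_set K (S : {set 'rV['F_2]_K}) : Prop :=
  [/\ exists u : 'cV_K, {in S, forall r, r *m u = 1},
      {in S &, forall a b, a != b -> exists c e, set_quad S a b c e}
    & forall (W : {set 'rV_K}) a, (#|W| <= 4)%N -> a \in W -> a \in S ->
        exists b c e, [/\ set_quad S a b c e, b \notin W, c \notin W & e \notin W]].

Section SetFamily.
Variables (d K : nat).
Hypothesis d_gt0 : (0 < d)%N.

Lemma check_of_set (S : {set 'rV['F_2]_K}) : #|S| = d -> good_set S ->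
  exists2 H : 'M['F_2]_(d, K), good_check H & S = [set row i H | i : 'I_d].
Proof.
move=> cS [[u uS] pairS rigS].
pose r (i : 'I_d) : 'rV['F_2]_K := enum_val (cast_ord (esym cS) i).
pose H := \matrix_i r i; have rowH i : row i H = r i by rewrite rowK.
have rS i : r i \in S by apply: enum_valP.
have rinj : injective r by move=> i j /enum_val_inj/cast_ord_inj.
have rsurj x : x \in S -> exists i, x = r i.
  move=> xS; exists (cast_ord cS (enum_rank_in xS x)).
  by rewrite /r cast_ordK enum_rankK_in.
have quad a b c e : set_quad S (r a) b c e -> exists b' c' e',
    [/\ b = r b', c = r c', e = r e' & row_quad H a b' c' e'].
  move=> [uabce /rsurj[b' bE] /rsurj[c' cE] /rsurj[e' eE] abce].
  exists b', c', e'; split=> //; split; last by rewrite !rowH -bE -cE -eE.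
  by rewrite -(map_inj_uniq rinj) /= -bE -cE -eE.
exists H; last first.
  apply/setP=> x; apply/idP/imsetP => [/rsurj[i ->]|[i _ ->]]; last by rewrite rowH.
  by exists i; rewrite ?rowH.
split.
- exists u; apply/row_matrixP=> i; rewrite row_mul rowH uS //.
  by apply/matrixP=> a b; rewrite !ord1 !mxE.
- by move=> i j; rewrite !rowH => /rinj.
- move=> a b ab; have [|c [e q]] := pairS (r a) (r b) (rS a) (rS b); first by rewrite (inj_eq rinj).
  have [b' [c' [e' [/rinj bE cE eE q']]]] := quad _ _ _ _ q.
  by exists c', e'; rewrite bE.
- move=> W a W4 aW; have [|||b [c [e [q bW cW eW]]]] := rigS (r @: W) (r a).
  + exact: leq_trans (leq_imset_card _ _) W4.
  + exact: imset_f.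
  + exact: rS.
  have [b' [c' [e' [bE cE eE q']]]] := quad _ _ _ _ q.
  by exists b', c', e'; split=> //; [move: bW | move: cW | move: eW];
    apply: contraNN; rewrite ?bE ?cE ?eE; apply: imset_f.
Qed.

(** Within one isomorphism class every [S u] is the image of a fixed [S u0] under a [K] by [K]
    matrix over [F_2], so the class meets the family at most [2 ^ (K * K)] times. *)
Lemma set_family_bound (U : finType) (S : U -> {set 'rV['F_2]_K}) (p : nat) :
  injective S -> (forall u, #|S u| = d) -> (forall u, good_set (S u)) ->
  perfect_class_count d p -> (#|U| <= p * 2 ^ (K * K))%N.
Proof.
move=> Sinj Sd Sgood pcc.
have /fin_all_exists[H HP] u : exists H : 'M['F_2]_(d, K),
    good_check H /\ S u = [set row i H | i : 'I_d].
  by have [H] := check_of_set (Sd u) (Sgood u); exists H.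
have /fin_all_exists[B BP] u : exists B : 'M[int]_d,
    \det B != 0 /\ forall x, in_lat (H u) x <-> exists z, x = z *m B.
  by have [B] := in_lat_basis (H u); exists B.
apply: (class_count_ge pcc (f := fun u => B u *m (B u)^T)).
  by move=> u; have [gH _] := HP u; have [B0 latB] := BP u; apply: gram_ppimx gH B0 latB.
move=> D isoD; have [->|[u0 u0D]] := set_0Vmem D; first by rewrite cards0.
have /fin_all_exists[M MP] u : exists M : 'M['F_2]_K, u \in D -> S u = [set x *m M | x in S u0].
  case: (boolP (u \in D)) => uD; last by exists 0.
  have [gH SE] := HP u0; have [B0 latB] := BP u0; have [_ latB'] := BP u.
  have [q [M ME]] := iso_check_equiv gH latB latB' (isoD _ _ u0D uD).
  exists M => _; rewrite SE (proj2 (HP u)).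
  apply/setP=> x; apply/imsetP/imsetP => [[i _ ->]|[y /imsetP[i _ ->] ->]].
    by exists (row (q i) (H u0)); [apply/imsetP; exists (q i) | rewrite ME].
  by exists (q^-1%g i); rewrite // ME permKV.
have : (#|M @: D| <= #|{: 'M['F_2]_K}|)%N := max_card _.
rewrite card_in_imset => [|u v uD vD Muv]; last by apply: Sinj; rewrite (MP u uD) (MP v vD) Muv.
by rewrite card_mx card_Fp.
Qed.
End SetFamily.

(** * Sets built from the four cosets of a subspace of codimension 2 *)

Section Layers.
Variable m : nat.
Notation V := ('rV['F_2]_2 * 'rV['F_2]_m)%type.
Implicit Types (Z W : {set V}) (a b c e : V).

Lemma pair_opp a : - a = a.
Proof. by case: a => t x; congr (_, _); rewrite /= F2_oppmx. Qed.

Lemma pair_quad a b c : a != b -> c != a -> c != b ->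
  uniq [:: a; b; c; a + b + c] /\ a + b + c + (a + b + c) = 0.
Proof.
move=> ab ca cb; split; last by rewrite -{2}[a + b + c]pair_opp subrr.
have addxx x : x + x = 0 :> V by rewrite -{2}[x]pair_opp subrr.
rewrite /= !inE !negb_or ab [a == c]eq_sym ca [b == c]eq_sym cb !andbT /=.
apply/and3P; split.
- rewrite -addrA -{1}[a]addr0 (inj_eq (addrI a)) eq_sym addr_eq0 pair_opp eq_sym //.
- rewrite addrAC -{1}[b]add0r (inj_eq (addIr b)) eq_sym addr_eq0 pair_opp eq_sym //.
- by rewrite -{1}[c]add0r (inj_eq (addIr c)) eq_sym addr_eq0 pair_opp.
Qed.

Definition layer Z (t : 'rV['F_2]_2) : {set 'rV['F_2]_m} := [set x | (t, x) \in Z].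

Lemma layer_avoid Z t W : (#|W| < #|layer Z t|)%N ->
  exists x, (t, x) \in Z /\ (t, x) \notin W.
Proof.
move=> WZ; have inj : injective (fun x : 'rV['F_2]_m => (t, x)) by move=> x y [].
have : ~~ ([set (t, x) | x in layer Z t] \subset W).
  by apply/negP=> /subset_leq_card; rewrite card_imset // leqNgt WZ.
case/subsetPn=> _ /imsetP[x xZ ->] xW; exists x; split=> //.
by rewrite inE in xZ.
Qed.

(** Five points in a layer allow avoiding the at most four elements of [W]; ten points in the full
    layer 0 allow avoiding [b], [W] and [a + b + W], at most nine points. *)
Definition layered Z : Prop :=
  [/\ forall x, (0, x) \in Z, forall t, (5 <= #|layer Z t|)%N & (10 <= 2 ^ m)%N].

(** Take the third point in the layer [a.1 + b.1]; the fourth, the sum of the other three, then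
    falls in layer 0, which is full. *)
Lemma layered_pairs Z : layered Z -> {in Z &, forall a b, a != b ->
  exists c e, [/\ uniq [:: a; b; c; e], c \in Z, e \in Z & a + b + c + e = 0]}.
Proof.
move=> [Z0 Z5 _] a b aZ bZ ab.
have [|x [vZ vW]] := @layer_avoid Z (a.1 + b.1) [set a; b].
  by apply: leq_trans (Z5 _); rewrite cards2; case: (_ != _).
set v := (_, x) in vZ vW; move: vW; rewrite !inE negb_or => /andP[va vb].
have [u4 s0] := pair_quad ab va vb; exists v, (a + b + v); split=> //.
have -> : a + b + v = (0, a.2 + b.2 + x); last exact: Z0.
by apply: injective_projections; rewrite //= -{2}[a.1 + b.1]F2_oppmx subrr.
Qed.

(** Take [b] in the layer of [a] and [c] in layer 0; then [a + b + c] lies in layer 0 as well, and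
    [c] is chosen so that this sum avoids [W]. *)
Lemma layered_rigid Z W a : layered Z -> (#|W| <= 4)%N -> a \in W -> a \in Z ->
  exists b c e, [/\ uniq [:: a; b; c; e], [/\ b \in Z, c \in Z & e \in Z],
    [/\ b \notin W, c \notin W & e \notin W] & a + b + c + e = 0].
Proof.
move=> [Z0 Z5 m10] W4 aW aZ.
have [|y [bZ bW]] := @layer_avoid Z a.1 W; first exact: leq_trans (Z5 _).
set b := (_, y) in bZ bW.
have [|x [cZ cW]] := @layer_avoid Z 0 (b |: (W :|: [set a + b + w | w in W])).
  rewrite [layer Z 0](_ : _ = setT); last by apply/setP=> x; rewrite !inE Z0.
  rewrite cardsT card_mx (card_Fp (isT : prime 2)) mul1n.
  apply: leq_trans m10; rewrite ltnS; apply: leq_trans (leq_card_setU _ _) _.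
  rewrite cards1 add1n ltnS; apply: leq_trans (leq_card_setU _ _) _.
  by rewrite (@leq_add _ _ 4 4) // (leq_trans (leq_imset_card _ _)).
set c := (0, x) in cZ cW; move: cW; rewrite !inE !negb_or => /and3P[cb cW abcW].
have eW : a + b + c \notin W.
  apply: contra abcW => eW; apply/imsetP; exists (a + b + c) => //.
  by rewrite addrA -{1}[a + b]pair_opp addNr add0r.
have ab : a != b by apply: contraNneq bW => <-.
have ca : c != a by apply: contraNneq cW => ->.
have [u4 s0] := pair_quad ab ca cb; exists b, c, (a + b + c); split=> //; split=> //.
have -> : a + b + c = (0, a.2 + y + x); last exact: Z0.
by apply: injective_projections; rewrite //= addr0 -{2}[a.1]F2_oppmx subrr.
Qed.

(** The leading coordinate 1 is the parity check that makes all words even. *)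
Definition layer_vec (a : V) : 'rV['F_2]_(1 + 2 + m) := row_mx (row_mx 1%:M a.1) a.2.

Lemma layer_vec_inj : injective layer_vec.
Proof. by move=> [t x] [t' x'] /eq_row_mx[/eq_row_mx[_ /= ->] /= ->]. Qed.

Lemma layer_vec_quad a b c e : a + b + c + e = 0 ->
  layer_vec a + layer_vec b + layer_vec c + layer_vec e = 0.
Proof.
case: a b c e => [t x] [t' x'] [t2 x2] [t3 x3] [tE xE].
have four : 1%:M + 1%:M + 1%:M + 1%:M = 0 :> 'M['F_2]_1.
  by apply/matrixP=> i j; rewrite !ord1 !mxE; apply: val_inj.
by rewrite /layer_vec !add_row_mx /= tE xE four !row_mx0.
Qed.

Lemma layered_good_set Z : layered Z -> good_set (layer_vec @: Z).
Proof.
move=> layZ; split.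
- exists (col_mx (col_mx 1%:M 0) 0) => _ /imsetP[a _ ->].
  by rewrite /layer_vec !mul_row_col !mulmx0 !addr0 mulmx1.
- move=> _ _ /imsetP[a aZ ->] /imsetP[b bZ ->]; rewrite (inj_eq layer_vec_inj) => ab.
  have [c [e [u4 cZ eZ s0]]] := layered_pairs layZ aZ bZ ab.
  exists (layer_vec c), (layer_vec e); split; rewrite ?imset_f //.
    by rewrite -(map_inj_uniq layer_vec_inj) in u4.
  exact: layer_vec_quad.
- move=> W r W4 rW /imsetP[a aZ aE]; rewrite {r}aE in rW *.
  have [||b [c [e [u4 [bZ cZ eZ] [bW cW eW] s0]]]] := @layered_rigid Z (layer_vec @^-1: W) a layZ _ _ aZ.
  + by apply: leq_trans W4; rewrite -(card_imset _ layer_vec_inj) subset_leq_card //;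
      apply/subsetP=> _ /imsetP[x xW ->]; rewrite inE in xW.
  + by rewrite inE.
  rewrite !inE in bW cW eW.
  exists (layer_vec b), (layer_vec c), (layer_vec e); split=> //; split; rewrite ?imset_f //.
    by rewrite -(map_inj_uniq layer_vec_inj) in u4.
  exact: layer_vec_quad.
Qed.
End Layers.

Lemma subset_between (T : finType) (A C : {set T}) k :
  A \subset C -> (#|A| <= k <= #|C|)%N ->
  exists Z : {set T}, [/\ A \subset Z, Z \subset C & #|Z| = k].
Proof.
move=> AC /andP[]; elim: k => [|k IH].
  by rewrite leqn0 cards_eq0 => /eqP-> _; exists set0; split; rewrite ?sub0set ?cards0.
rewrite leq_eqVlt => /predU1P[Ak _|]; first by exists A; split; rewrite ?subxx.
rewrite ltnS => Ak kC; have [Z [AZ ZC Zk]] := IH Ak (ltnW kC).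
have /subsetPn[x xC xZ] : ~~ (C \subset Z).
  by apply/negP=> /subset_leq_card; rewrite Zk leqNgt kC.
exists (x |: Z); split; first by rewrite subsetU // AZ orbT.
  by rewrite subUset sub1set xC.
by rewrite cardsU1 xZ Zk.
Qed.

Lemma perfect_class_count_ge m q d p :
  (60 <= 2 ^ m)%N -> (2 ^ m = 4 * q)%N -> (3 * 2 ^ m <= 2 * d < 6 * 2 ^ m)%N ->
  perfect_class_count d p -> (2 ^ q <= p * 2 ^ ((m + 3) * (m + 3)))%N.
Proof.
set n := (2 ^ m)%N => n60 n4 /andP[nd dn] pcc.
pose X := 'rV['F_2]_m.
have cX : #|[set: X]| = n by rewrite cardsT card_mx card_Fp // mul1n.
have cT : #|[set: 'rV['F_2]_2]| = 4 by rewrite cardsT card_mx card_Fp.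
have [|Y [_ _ Yq]] := @subset_between X set0 setT q (sub0set _).
  by rewrite cards0 cX /=; lia.
have cCY : #|~: Y| = (n - q)%N by rewrite cardsCs setCK Yq -cX cardsT.
have [|E [_ EY E5]] := @subset_between X set0 (~: Y) 5 (sub0set _).
  by rewrite cards0 cCY /=; lia.
pose t1 : 'rV['F_2]_2 := delta_mx 0 0; pose t2 : 'rV['F_2]_2 := delta_mx 0 1.
have t1n : t1 != 0 by apply/eqP=> /matrixP/(_ 0 0); rewrite !mxE.
have t2n : t2 != 0 by apply/eqP=> /matrixP/(_ 0 1); rewrite !mxE.
have t12 : t1 != t2 by apply/eqP=> /matrixP/(_ 0 0); rewrite !mxE.
pose base := setX [set 0 : 'rV['F_2]_2] [set: X].
pose region := setX [set t1; t2] Y.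
have cbase : #|base| = n by rewrite cardsX cards1 cX mul1n.
have cregion : #|region| = (2 * q)%N by rewrite cardsX cards2 t12 Yq.
have dis : base :&: region = set0.
  apply/setP=> -[t x]; rewrite !inE /= andbT; case: (eqVneq t 0) => //= ->.
  by rewrite eq_sym (negPf t1n) eq_sym (negPf t2n).
have cfree : #|~: (base :|: region)| = (3 * n - 2 * q)%N.
  rewrite cardsCs setCK cardsU dis cards0 cbase cregion -cardsT.
  have -> : [set: 'rV['F_2]_2 * X] = setX setT setT by apply/setP=> x; rewrite !inE.
  by rewrite cardsX cX cT; lia.
(* The filler contains the five points [E] in each of the three nonzero layers: its size [d - n - q]
   is at least [n / 4], and [n >= 60] makes this at least 15. *)
have [||Z0 [MZ0 Z0free cZ0]] :=
    @subset_between _ (setX (~: [set 0]) E) (~: (base :|: region)) (d - n - q)%N.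
- apply/subsetP=> -[t x]; rewrite !inE /= andbT => /andP[tn xE]; rewrite (negPf tn) /=.
  by move/subsetP/(_ x xE): EY; rewrite inE => /negPf->; rewrite andbF.
- rewrite cfree cardsX E5 cardsCs setCK -[#|{: _}|]cardsT cT cards1; lia.
(* Placing [U] in layer [t1] and its complement in [Y] in layer [t2] keeps the size equal to [q] for
   every [U]. *)
pose part (U : {set X}) := setX [set t1] U :|: setX [set t2] (Y :\: U).
have part_region (U : {set X}) : U \subset Y -> part U \subset region.
  move=> /subsetP UY; apply/subsetP=> -[t x]; rewrite !inE /=.
  by case/orP=> [/andP[-> /UY->]|/and3P[-> _ ->]]; rewrite ?orbT.
have cpart (U : {set X}) : U \subset Y -> #|part U| = q.
  move=> UY; rewrite cardsU !cardsX !cards1 !mul1n cardsD (setIidPr UY) Yq.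
  rewrite [_ :&: _](_ : _ = set0) ?cards0; last first.
    apply/setP=> -[t x]; rewrite !inE /=; case: (eqVneq t t1) => [->|] //=.
    by rewrite (negPf t12) andbF.
  by have := subset_leq_card UY; rewrite Yq; lia.
pose UT := {U : {set X} | U \subset Y}.
pose Z (u : UT) := base :|: part (val u) :|: Z0.
have cZ u : #|Z u| = d.
  have pr := part_region _ (valP u).
  rewrite cardsU (cardsU base) cbase cpart ?(valP u) // cZ0.
  rewrite [base :&: _](_ : _ = set0); last first.
    by apply/eqP; rewrite -subset0 -dis (setIS base pr).
  rewrite [_ :&: Z0](_ : _ = set0); last first.
    apply/eqP; rewrite setIC -subset0 -(setICr (base :|: region)) setIC setISS //.
    by rewrite setUS.
  by rewrite !cards0; lia.
have layZ u : layered (Z u).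
  split.
  - by move=> x; rewrite !inE eqxx.
  - move=> t; case: (eqVneq t 0) => [->|tn].
      rewrite [layer _ _](_ : _ = setT) ?cX; first by lia.
      by apply/setP=> x; rewrite !inE eqxx.
    rewrite -E5 subset_leq_card //; apply/subsetP=> x xE; rewrite !inE.
    by rewrite (subsetP MZ0) ?orbT // !inE /= tn xE.
  - by rewrite -/n; lia.
have Zinj : injective Z.
  move=> u v uv; apply: val_inj; apply/setP=> x.
  case: (boolP (x \in Y)) => xY; last first.
    have out (w : UT) : (x \in val w) = false.
      by apply: contraNF xY; exact: (subsetP (valP w)).
    by rewrite !out.
  have xZ0 : (t1, x) \notin Z0.
    apply/negP=> /(subsetP Z0free); rewrite !inE /= eqxx xY orbT //.
  have mem w : ((t1, x) \in Z w) = (x \in val w).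
    by rewrite !inE (negPf xZ0) /= (negPf t1n) eqxx (negPf t12) /= !orbF.
  by rewrite -!mem uv.
have d0 : (0 < d)%N by lia.
have cUT : #|{: UT}| = (2 ^ q)%N.
  by rewrite card_sig -Yq -card_powerset; apply: eq_card => U; rewrite !inE.
rewrite -cUT (addnC m 3).
apply: (set_family_bound d0 (S := fun u => @layer_vec m @: Z u)) pcc.
- by move=> u v /imset_inj => /(_ (@layer_vec_inj m))/Zinj.
- by move=> u; rewrite card_imset //; apply: layer_vec_inj.
- by move=> u; apply: layered_good_set.
Qed.

(** * Estimates of exponents and choice of parameters *)

Lemma upper_exponent d : (3 <= d)%N ->
  ((d ^ d).+1 * (d ^ d).+1 ^ (d * d) * (d ^ d * 3 ^ d) ^ (d * d) <= d ^ (6 * d ^ 3))%N.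
Proof.
move=> d3; have d0 : (0 < d)%N by lia.
have h1 : ((d ^ d).+1 <= d ^ d.+1)%N.
  have : (0 < d ^ d)%N by rewrite expn_gt0 d0.
  by rewrite expnS; nia.
have h2 : (d ^ d * 3 ^ d <= d ^ (d + d))%N by rewrite expnD leq_mul2l leq_exp2r ?d3 ?orbT.
have dd0 : (0 < d * d)%N by rewrite muln_gt0 d0.
apply: (@leq_trans (d ^ d.+1 * (d ^ d.+1) ^ (d * d) * (d ^ (d + d)) ^ (d * d))%N).
  by rewrite !leq_mul ?leq_exp2r.
rewrite -!expnM -!expnD leq_exp2l; last by lia.
have -> : (d ^ 3 = d * (d * d))%N by rewrite !expnS expn0 muln1.
by rewrite mulSn mulnDl; nia.
Qed.

Lemma expn_pow a k : expn a k = Nat.pow a k.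
Proof. by elim: k => // k IH; rewrite expnS IH. Qed.

(** Induction from [m = 11], where the claim is [392 <= 512]. *)
Lemma square_le_exp2 m : (11 <= m)%N -> (2 * ((m + 3) * (m + 3)) <= 2 ^ (m - 2))%N.
Proof.
move=> m11.
have H k : (2 * ((k + 14) * (k + 14)) <= 2 ^ (k + 9))%N.
  by elim: k => // k IH; rewrite !addSn expnS; nia.
have -> : (m + 3 = m - 11 + 14)%N by lia.
by have -> : (m - 2 = m - 11 + 9)%N by lia.
Qed.

Lemma perfect_class_count_bounds d : Nat.le (Nat.mul 6 1024) d ->
  exists p k : nat, [/\ perfect_class_count d p, Nat.le p (Nat.pow d (Nat.mul 6 (Nat.pow d 3))),
    Nat.le d (Nat.mul 24 k) & Nat.le (Nat.pow 2 k) p].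
Proof.
move=> /ssrnat.leP d_large; have d0 : (0 < d)%N by lia.
have [p pK pcc] := perfect_class_count_le d0.
(* The largest [m] with [3 * 2 ^ m <= 2 * d], as the family of sets requires. *)
pose m := trunc_log 2 ((2 * d) %/ 3).
have /andP[mlo mhi] : (2 ^ m <= (2 * d) %/ 3 < 2 ^ m.+1)%N by apply: trunc_log_bounds; lia.
have m11 : (11 <= m)%N.
  rewrite leqNgt; apply/negP=> m11; have : (2 ^ m.+1 <= 2 ^ 11)%N by rewrite leq_exp2l.
  by rewrite -[(2 ^ 11)%N]/(2 * 1024)%N; lia.
have sq := square_le_exp2 m11.
have E : (2 ^ m = 4 * 2 ^ (m - 2))%N by rewrite -(expnD 2 2) subnKC; lia.
have lowp : (2 ^ (2 ^ (m - 2)) <= p * 2 ^ ((m + 3) * (m + 3)))%N.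
  by apply: perfect_class_count_ge E _ pcc; rewrite expnS in mhi; nia.
rewrite expnS in mhi.
(* By [sq] this [k] is at least [2 ^ (m - 3)], and [d < 3 * 2 ^ m = 24 * 2 ^ (m - 3)]. *)
exists p, (2 ^ (m - 2) - (m + 3) * (m + 3))%N; split=> //; apply/ssrnat.leP; last 1 first.
- rewrite -expn_pow -(leq_pmul2r (_ : 0 < 2 ^ ((m + 3) * (m + 3)))%N) ?expn_gt0 //.
  by rewrite -expnD subnK //; lia.
- by rewrite -!expn_pow; apply: leq_trans pK (upper_exponent _); lia.
- lia.
Qed.
End PerfectLattices.

Theorem theorem1p1 :
  forall eps : R, (0 < eps)%R ->
  exists N : nat, forall d : nat, (N <= d)%nat ->
    exists p : nat, perfect_class_count d p /\
      (exp (Rpower (INR d) (1 - eps)) < INR p)%R /\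
      (INR p < exp (Rpower (INR d) (3 + eps)))%R.
Proof.
intros eps eps_gt0.
destruct (upper_asymptotics eps eps_gt0) as [N1 upper].
destruct (lower_asymptotics eps eps_gt0) as [N2 lower].
exists (N1 + N2 + 6 * 1024)%nat; intros d d_large.
destruct (@PerfectLattices.perfect_class_count_bounds d) as [p [k [count p_le d_le p_ge]]];
  [lia |].
exists p; split; [exact count | split].
- apply (lower d p k); [lia | exact d_le | exact p_ge].
- apply (upper d p); [lia | exact p_le].
Qed.
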